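(* Let $\boldsymbol{a}$ be a weak composition of $r$ of length $k$ and $\boldsymbol{b}$ a weak composition of $s$ of length $m$, and let $n\geq 2r+2s$. The map $\mathrm{smRSK}$ is a bijection $$\hat\Pi_{2(\boldsymbol{a},\boldsymbol{b})}\ \longrightarrow\ \biguplus_{\substack{\lambda\vdash n\\ \mathcal{SSMT}(\lambda,\boldsymbol{a},\boldsymbol{b})\neq\emptyset}}\mathcal{SSMT}(\lambda,\boldsymbol{a},\boldsymbol{b})\times\mathcal{SSMT}(\lambda,\boldsymbol{a},\boldsymbol{b}).$$
   Context: **Alphabets and multisets.** A weak composition of $r$ of length $k$ is a sequence of $k$ non-negative integers with sum $r$. We use four disjoint alphabets of symbols: $i$ (plain), $\overline{i}$ (barred), $\underline{i}$ (underlined), $\underline{\overline{i}}$ (barred and underlined), $i\ge 1$; symbols $\overline i$ and $\underline{\overline i}$ are called barred, $\underline i$ and $\underline{\overline i}$ underlined. Each alphabet is ordered as the integers, and $i<\overline{j}<\underline{k}<\underline{\overline{m}}$ for all $i,j,k,m$. Let $[k]^{\boldsymbol{a}}$ be the multiset in which $i$ has multiplicity $\boldsymbol{a}_i$ $(1\le i\le k)$, and define $[\overline{m}]^{\boldsymbol{b}}$, $[\underline{k}]^{\boldsymbol{a}}$, $[\underline{\overline{m}}]^{\boldsymbol{b}}$ likewise. A multiset partition of a multiset $\tilde S$ is a multiset of nonempty multisets (blocks) whose multiset union is $\tilde S$. Throughout, no barred symbol is repeated inside a single block (but $\overline i$ and $\underline{\overline i}$ are different symbols and may lie in the same block). The set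 $\hat\Pi_{2(\boldsymbol{a},\boldsymbol{b})}$ of restricted multiset partitions consists of the multiset partitions of $[k]^{\boldsymbol{a}}\uplus[\overline{m}]^{\boldsymbol{b}}\uplus[\underline{k}]^{\boldsymbol{a}}\uplus[\underline{\overline{m}}]^{\boldsymbol{b}}$ satisfying this, in which every block occurring more than once has an even number of barred entries. A block is propagating if it contains both an underlined and a non-underlined symbol. **Last-letter order.** For multisets $\tilde S,\tilde R$ over a totally ordered alphabet, $\tilde S<\tilde R$ if (i) $\tilde S$ is empty and $\tilde R$ is not, or (ii) $\max\tilde S<\max\tilde R$, or (iii) $\max\tilde S=\max\tilde R=u$ and $\tilde S\smallsetminus\{u\}<\tilde R\smallsetminus\{u\}$ (removing one copy of $u$). **Tableaux.** Young diagrams are drawn in French convention (row 1 at the bottom, of length $\lambda_1$). A multiset partition tableau of shape $\lambda$ is a filling of the boxes of the Young diagram of $\lambda$ by multisets such that every box above the first row is nonempty, while in the first row some boxes are empty, including the first $\lambda_2$ ones (no nonempty box of the first row lies under a box of the second row). Its content is the multiset of contents of its nonempty boxes. $\mathcal{SSMT}(\lambda,\boldsymbol{a},\boldsymbol{b})$ is the set of semistandard multiset partition tableaux of shape $\lambda$ whose content is a multiset partition of $[k]^{\boldsymbol{a}}\uplus[\overline{m}]^{\boldsymbol{b}}$ (no barred symbol repeated inside a block), where semistandard means: rows (left to right) and columns (bottom to top) weakly increase in the last-letter order; two identical blocks with an even number of barred entries are never in the same column; two identical blocks with an odd number of barred entries are never in the same row. **Super RSK.** Let $\mathscr{M}$ be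 the set of multisets with entries in $\{1,2,\dots\}\cup\{\overline1,\overline2,\dots\}$, ordered by the last-letter order. Call $S\in\mathscr{M}$ even ($\varepsilon(S)=0$) or odd ($\varepsilon(S)=1$) according to the parity of its number of barred entries. Order pairs $(a,b)\in\mathscr{M}\times\mathscr{M}$ by: $(a_1,b_1)\prec(a_2,b_2)$ if $a_1<a_2$, or $a_1=a_2$ and one of: $\varepsilon(b_1)=1$, $\varepsilon(b_2)=0$; or $\varepsilon(b_1)=\varepsilon(b_2)=0$ and $b_1<b_2$; or $\varepsilon(b_1)=\varepsilon(b_2)=1$ and $b_1>b_2$. $0$-insertion of $a$ into a tableau $T$: start with the first row of $T$ if $a$ is even, the first column if $a$ is odd. Inserting an even (resp. odd) value $a$ into a row (resp. column): (i) if $a$ is larger than or equal to every element of that row (column), put $a$ at its end and stop; (ii) otherwise the left-most (resp. bottom-most) box of that row (column) with content larger than $a$ is the bump site; let $b$ be its content and replace it with $a$; (iii) if $b$ is even, insert $b$ (by the same rules) into the row directly above the bump site; if $b$ is odd, insert $b$ into the column directly to the right of the bump site. $1$-insertion is obtained from $0$-insertion by swapping ''row'' and ''column'' and making comparisons strict: even values are inserted into columns and odd values into rows (starting with the first column, resp. row); in (i) one requires $a$ strictly larger than every element; in (ii) the bump site is the bottom-most (even $a$, column) resp. left-most (odd $a$, row) box with content larger than or equal to $a$; in (iii) an even bumped $b$ goes to the column directly to the right of the bump site, an odd $b$ to the row directly above it. For a biword $w=((a_1,b_1),\dots,(a_\ell,b_\ell))$ sorted weakly increasingly in $\preceq$,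 start with $P=Q=\emptyset$; for $i=1,\dots,\ell$, insert $b_i$ into $P$ by $\varepsilon(a_i)$-insertion, and add to $Q$ a box with content $a_i$ in the position of the box newly created in $P$. Put $\mathrm{sRSK}(w)=(P,Q)$ for the final pair. **The map $\mathrm{smRSK}$.** For $\hat\pi\in\hat\Pi_{2(\boldsymbol{a},\boldsymbol{b})}$ with propagating blocks $\tilde S_1,\dots,\tilde S_\ell$ (with multiplicity), let $\tilde S_i^-$ be the multiset of underlined entries of $\tilde S_i$ with underlines removed and $\tilde S_i^+$ the multiset of the remaining entries. Let $w(\hat\pi)$ be the biword consisting of the pairs $(\tilde S_i^+,\tilde S_i^-)$ sorted in $\preceq$. Let $(P,Q)=\mathrm{sRSK}(w(\hat\pi))$, of common shape $\mu$; then $n-|\mu|\ge|\mu|$. Form a tableau $P'$ of shape $(n-|\mu|,\mu)$ by placing $P$ above a new first row of length $n-|\mu|$, consisting of empty boxes followed by the blocks of $\hat\pi$ that have only underlined entries (underlines removed), in weakly increasing last-letter order. Form $Q'$ from $Q$ in the same way using the blocks of $\hat\pi$ that have only non-underlined entries. Then $\mathrm{smRSK}(\hat\pi)=(P',Q')$. *)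

(* Defs.v *)
From HB Require Import structures.
From mathcomp Require Import all_boot all_order finmap multiset.
From mathcomp Require Import classical_sets functions.

Set Implicit Arguments.
Unset Strict Implicit.
Unset Printing Implicit Defensive.

Import Order.TTheory.

Local Open Scope classical_set_scope.
Local Open Scope mset_scope.
Local Open Scope nat_scope.

(* A letter is a pair (barred?, index) and a symbol is a pair
   (underlined?, letter).  Both are ordered lexicographically with
   false < true, i.e. plain < barred < underlined < underlined and barred,
   each alphabet being ordered by its index. *)
Definition letter : Type := bool *l nat.
Definition symbol : Type := bool *l letter.

Definition barred (x : letter) : bool := x.1.
Definition underlined (x : symbol) : bool := x.1.
Definition letter_of (x : symbol) : letter := x.2.

Section LastLetter.
Context {d : Order.disp_t} {T : orderType d}.
Implicit Types S R : {mset T}.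

Definition desc S : seq T := sort >=%O S.

(* The head of desc S is max S and its tail is desc (S `\ max S); the defining
   clauses (i)-(iii) of the last-letter order are lemmas llt0m, lltm0, lltE. *)
Fixpoint llt_seq (s t : seq T) : bool :=
  match s, t with
  | _, [::] => false
  | [::], _ :: _ => true
  | u :: s', v :: t' => (u < v)%O || (u == v) && llt_seq s' t'
  end.

Definition llt S R : bool := llt_seq (desc S) (desc R).
Definition lle S R : bool := (S == R) || llt S R.

Lemma desc0 : desc mset0 = [::].
Proof. by rewrite /desc enum_mset0. Qed.

Lemma desc_eq0 S : (desc S == [::]) = (S == mset0).
Proof. by rewrite -size_eq0 size_sort size_mset_eq0. Qed.

Lemma desc_max S u : u \in S -> {in S, forall x, (x <= u)%O} ->
  desc S = u :: desc (S `\ u).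
Proof.
move=> uS leu.
have geT : total (>=%O : rel T) by move=> x y; exact: le_total.
apply: (@sorted_eq _ (>=%O)) => //.
- by move=> y x z /= le_yx le_zy; exact: le_trans le_zy le_yx.
- by move=> x y /= le_xy; apply: le_anti; rewrite andbC.
- by apply: sort_sorted.
- rewrite /= path_min_sorted; first by apply: sort_sorted.
  by apply/allP => x; rewrite mem_sort => xS; apply: leu;
    move: xS; rewrite in_msetB1 => /andP[].
- apply/allP => x _; apply/eqP; rewrite /= !(permP (permEl (perm_sort _ _))).
  rewrite !count_mem_mset msetB1E [u == x]eq_sym.
  by have [->|_] := eqVneq x u; rewrite ?subn0 // subnKC // -in_mset.
Qed.

Lemma llt0m S : llt mset0 S = (S != mset0).
Proof. by rewrite /llt desc0 -desc_eq0; case: (desc S). Qed.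

Lemma lltm0 S : llt S mset0 = false.
Proof. by rewrite /llt desc0; case: (desc S). Qed.

Lemma lltE S R u v :
    u \in S -> {in S, forall x, (x <= u)%O} ->
    v \in R -> {in R, forall x, (x <= v)%O} ->
  llt S R = (u < v)%O || (u == v) && llt (S `\ u) (R `\ v).
Proof. by move=> uS leu vR lev; rewrite /llt (desc_max uS) // (desc_max vR). Qed.

End LastLetter.

Section MultisetPartitions.
Variables (T : choiceType).

Definition mset_partition (A : {mset T}) (p : {mset {mset T}}) : bool :=
  (mset0 \notin p) && (\big[msetD/mset0]_(B <- p) B == A).

Definition no_repeat (P : pred T) (B : {mset T}) : bool :=
  all (fun x => P x ==> (B x <= 1)) B.

End MultisetPartitions.

Section Contents.
Variables (k m : nat) (a : k.-tuple nat) (b : m.-tuple nat).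

Definition letters : {mset letter} :=
  (\big[msetD/mset0]_(i < k) msetn (tnth a i) ((false, i.+1) : letter))
  `+` (\big[msetD/mset0]_(j < m) msetn (tnth b j) ((true, j.+1) : letter)).

Definition symbols : {mset symbol} :=
  seq_mset [seq ((false, x) : symbol) | x <- letters]
  `+` seq_mset [seq ((true, x) : symbol) | x <- letters].

Definition restricted_mpartitions : set {mset {mset symbol}} :=
  [set p | [/\ mset_partition symbols p,
    all (no_repeat (barred \o letter_of)) p &
    forall B : {mset symbol}, 1 < p B -> ~~ odd (count (barred \o letter_of) B)]].

End Contents.

Notation block := {mset letter}.

Definition eps (S : block) : bool := odd (count barred S).

(* A tableau is the sequence of its rows, the first (bottom) row coming first;
   boxes are pairs (row, column), both counted from 0.  The empty multiset
   stands for an empty box. *)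
Definition tableau := seq (seq block).

Implicit Types (T : tableau) (r c : nat).

Definition row T r : seq block := nth [::] T r.
Definition column T c : seq block :=
  [seq nth mset0 R c | R <- T & c < size R].
Definition shape T : seq nat := map size T.
Definition nboxes T : nat := sumn (shape T).

Definition put T (z : nat * nat) (S : block) : tableau :=
  set_nth [::] T z.1 (set_nth mset0 (row T z.1) z.2 S).

Definition is_partition (n : nat) (l : seq nat) : bool :=
  [&& sorted geq l, 0 \notin l & sumn l == n].

(* The second condition concerns the rows above the first one.  The third says
   that the first row has an empty box, and is void for the empty diagram. *)
Definition mp_tableau (l : seq nat) T : Prop :=
  [/\ shape T = l,
      forall r, 0 < r -> mset0 \notin row T r,
      T != [::] -> mset0 \in row T 0 &
      forall c, c < nth 0 l 1 -> nth mset0 (row T 0) c = mset0].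

Definition content T : {mset block} :=
  seq_mset [seq S <- flatten T | S != mset0].

Definition semistandard T : Prop :=
  [/\ forall r, sorted lle (row T r),
      forall c, sorted lle (column T c),
      forall c S, S != mset0 -> ~~ eps S -> count_mem S (column T c) <= 1 &
      forall r S, S != mset0 -> eps S -> count_mem S (row T r) <= 1].

Definition SSMT (l : seq nat) k m (a : k.-tuple nat) (b : m.-tuple nat) :
    set tableau :=
  [set T | [/\ mp_tableau l T, mset_partition (letters a b) (content T),
    all (no_repeat barred) (content T) & semistandard T]].

(* insert_at fuel e T i S inserts S into the line of index i of T according to
   the rules of e-insertion; the line is a column when eps S differs from e,
   and a row otherwise.  The result is the new tableau and the new box.
   If p = size line, the entry is appended at position p of the line, and
   otherwise position p is the bump site.
   The fuel never runs out when it is at least (N + 1) ^ 2, N being the number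
   of boxes of T: inserted values weakly increase along the bumping process,
   at most N + 1 distinct values occur, and as long as the value is the same,
   the lines are all rows or all columns and their index increases. *)
Fixpoint insert_at (fuel : nat) (e : bool) T (i : nat) (S : block) :
    tableau * (nat * nat) :=
  let is_col := eps S (+) e in
  let line := if is_col then column T i else row T i in
  let p := find (fun R => if e then lle S R else llt S R) line in
  let z := if is_col then (p, i) else (i, p) in
  let T' := put T z S in
  if fuel is fuel'.+1 then
    if p < size line then
      let R := nth mset0 line p in
      insert_at fuel' e T' (if eps R (+) e then z.2.+1 else z.1.+1) R
    else (T', z)
  else (T', z).

Definition insertion (e : bool) T (S : block) : tableau * (nat * nat) :=
  insert_at ((nboxes T).+1 ^ 2) e T 0 S.

Definition sRSK_step (PQ : tableau * tableau) (x : block * block) :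
    tableau * tableau :=
  let: (P', z) := insertion (eps x.1) PQ.1 x.2 in (P', put PQ.2 z x.1).

Definition sRSK (w : seq (block * block)) : tableau * tableau :=
  foldl sRSK_step ([::], [::]) w.

Definition pair_lt (x y : block * block) : bool :=
  llt x.1 y.1 ||
  (x.1 == y.1) && [|| eps x.2 && ~~ eps y.2,
                      [&& ~~ eps x.2, ~~ eps y.2 & llt x.2 y.2] |
                      [&& eps x.2, eps y.2 & llt y.2 x.2]].
Definition pair_le (x y : block * block) : bool := (x == y) || pair_lt x y.

Definition minus_part (B : {mset symbol}) : block :=
  seq_mset [seq letter_of x | x <- B & underlined x].
Definition plus_part (B : {mset symbol}) : block :=
  seq_mset [seq letter_of x | x <- B & ~~ underlined x].

Definition only_underlined (B : {mset symbol}) : bool := all underlined B.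
Definition only_nonunderlined (B : {mset symbol}) : bool :=
  ~~ has underlined B.
Definition propagating (B : {mset symbol}) : bool :=
  has underlined B && ~~ all underlined B.

Definition biword (p : {mset {mset symbol}}) : seq (block * block) :=
  sort pair_le [seq (plus_part B, minus_part B) | B <- p & propagating B].

(* A first row of length 0, which arises only for n = 0, is not recorded. *)
Definition add_first_row (n : nat) T (s : seq block) : tableau :=
  let R := nseq (n - nboxes T - size s) mset0 ++ sort lle s in
  if nilp R then T else R :: T.

Definition smRSK (n : nat) (p : {mset {mset symbol}}) : tableau * tableau :=
  let: (P, Q) := sRSK (biword p) in
  (add_first_row n P [seq minus_part B | B <- p & only_underlined B],
   add_first_row n Q [seq plus_part B | B <- p & only_nonunderlined B]).

(* Main.v *)
Require Import Defs.
From mathcomp Require Import all_boot all_order finmap multiset.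
From mathcomp Require Import classical_sets functions.
From mathcomp Require Import zify.

(** The proof runs super RSK as a growth of shapes.

    A semistandard tableau is the same thing as the list of its entries in
    reading order (by value; equal even entries from left to right, equal odd
    ones from bottom to top), each with its box.  Along this list the boxes are
    added one at a time to a Young diagram, and two consecutive equal entries
    make a prescribed turn: to a later column for even ones, to a higher row for
    odd ones ([semistandard_entries], [entries_semistandard]).

    Inserting a value changes such a growth by Fomin's local rule [loc]: an
    entry keeps its box unless this is the box being added by the insertion, in
    which case it moves to the end of the next row or column.  Which of the two
    is decided by the parity of the entry together with the mode of insertion,
    but the turn made by two consecutive boxes survives the local rule in either
    case ([loc_turn]).  Everything follows from this fact, used in both
    directions of the growth.  Applied to equal entries of the tableau, it shows
    that insertion keeps a tableau semistandard, and that undoing an insertion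
    does so too ([ins_sorted], [ins_sorted_rev]).  Applied to two successive
    insertions in the same mode, it computes the turn between the two new boxes
    from the two inserted values ([ins_turn]); the outcome is precisely the
    order on biwords, so that a biword is in order if and only if its recording
    tableau is semistandard ([rsk_sorted]).  As the local rule is reversible
    ([ins_inj], [ins_surj]), ordered biwords correspond bijectively to pairs of
    semistandard tableaux of the same shape ([rsk_inj], [rsk_surj]).

    The bumping procedure computes these growths: it jumps from one bumped entry
    to the next, whereas the local rule also visits the entries in between and
    leaves them alone ([bump_ins], [sRSK_rsk]).  Every bump uses up one of the
    entries that remain to be visited, which bounds the number of steps.

    Finally, a restricted partition amounts to a biword, formed by its
    propagating blocks, and two lists of other blocks, which become the first
    rows.  All conditions on the partition split into conditions on these data
    ([restricted_pairs]), and since at most [n / 2] boxes carry blocks, the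
    first row is long enough to fit below the rest and is determined by its
    nonempty blocks ([add_first_row_SSMT], [SSMT_first_row]). *)

(** * Boxes, shapes and Fomin's local rule *)

Notation box := (nat * nat)%type.

Definition rlen (D : seq box) (r : nat) : nat := count (fun z => z.1 == r) D.
Definition clen (D : seq box) (c : nat) : nat := count (fun z => z.2 == c) D.

#[global] Arguments rlen : simpl never.
#[global] Arguments clen : simpl never.

(** With the row lengths and column heights as the only data on a shape, rows
    and columns play the same role; the condition says that both describe the
    same diagram. *)
Definition ideal (D : seq box) :=
  forall r c : nat, (c < rlen D r) = (r < clen D c).

Definition addable (D : seq box) (z : box) :=
  (z.2 == rlen D z.1) && (z.1 == clen D z.2).

Definition corner (D : seq box) (z : box) :=
  (z.2.+1 == rlen D z.1) && (z.1.+1 == clen D z.2).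

Fixpoint chain (D l : seq box) :=
  if l is z :: l' then addable D z && chain (rcons D z) l' else true.

Lemma rlen_perm D D' : perm_eq D D' -> rlen D =1 rlen D'.
Proof. by move=> /permP pD r; exact: pD. Qed.

Lemma clen_perm D D' : perm_eq D D' -> clen D =1 clen D'.
Proof. by move=> /permP pD r; exact: pD. Qed.

Lemma ideal_perm D D' : perm_eq D D' -> ideal D -> ideal D'.
Proof.
by move=> pD iD r c; rewrite -(rlen_perm _ _ pD) -(clen_perm _ _ pD).
Qed.

Lemma addable_perm D D' z : perm_eq D D' -> addable D z = addable D' z.
Proof.
by move=> pD; rewrite /addable (rlen_perm _ _ pD) (clen_perm _ _ pD).
Qed.

Lemma corner_perm D D' z : perm_eq D D' -> corner D z = corner D' z.
Proof.
by move=> pD; rewrite /corner (rlen_perm _ _ pD) (clen_perm _ _ pD).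
Qed.

Lemma addableP D z : reflect (z.2 = rlen D z.1 /\ z.1 = clen D z.2)
  (addable D z).
Proof.
by apply: (iffP andP) => [[/eqP ? /eqP ?]|[/eqP ? /eqP ?]].
Qed.

Lemma cornerP D z : reflect (z.2.+1 = rlen D z.1 /\ z.1.+1 = clen D z.2)
  (corner D z).
Proof.
by apply: (iffP andP) => [[/eqP ? /eqP ?]|[/eqP ? /eqP ?]].
Qed.

Lemma rlen_cons z D r : rlen (z :: D) r = (z.1 == r) + rlen D r.
Proof. by []. Qed.

Lemma clen_cons z D c : clen (z :: D) c = (z.2 == c) + clen D c.
Proof. by []. Qed.

Lemma ideal_cons D z : ideal D -> addable D z -> ideal (z :: D).
Proof.
move=> iD /addableP[z2 z1] r c; rewrite rlen_cons clen_cons.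
have := iD r c; have [<-|] := eqVneq z.1 r; have [<-|] := eqVneq z.2 c; lia.
Qed.

Lemma corner_cons D z : corner (z :: D) z = addable D z.
Proof. by rewrite /corner /addable rlen_cons clen_cons !eqxx. Qed.

Lemma rlen_noninc D r r' : ideal D -> r <= r' -> rlen D r' <= rlen D r.
Proof. by move=> iD; have := iD r (rlen D r); have := iD r' (rlen D r); lia. Qed.

Lemma clen_noninc D c c' : ideal D -> c <= c' -> clen D c' <= clen D c.
Proof. by move=> iD; have := iD (clen D c) c; have := iD (clen D c) c'; lia. Qed.

Lemma chain_cat D l1 l2 : chain D (l1 ++ l2) = chain D l1 && chain (D ++ l1) l2.
Proof.
elim: l1 D => [|z l1 IH] D /=; first by rewrite cats0.
by rewrite IH -andbA cat_rcons.
Qed.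

Lemma chain_rcons l z : chain [::] (rcons l z) = chain [::] l && addable l z.
Proof. by rewrite -cats1 chain_cat /= andbT. Qed.

Lemma chain_ideal l : chain [::] l -> ideal l.
Proof.
elim/last_ind: l => [//|l z IH]; rewrite chain_rcons => /andP[/IH il az].
by apply: (@ideal_perm (z :: l)); rewrite 1?perm_sym ?perm_rcons //;
  apply: ideal_cons.
Qed.

Lemma rcons_perm (l : seq box) z : perm_eq (rcons l z) (z :: l).
Proof. by rewrite perm_rcons. Qed.

Lemma chain_mem l r c : chain [::] l -> ((r, c) \in l) = (c < rlen l r).
Proof.
elim/last_ind: l => [//|l z IH]; rewrite chain_rcons => /andP[cl az].
rewrite mem_rcons inE IH // (rlen_perm _ _ (rcons_perm l z)) rlen_cons.
move/addableP: az; case: z => z1 z2 /= [z2E _]; rewrite xpair_eqE.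
by have [<-|] := eqVneq z1 r; rewrite ?eqxx ?z2E; lia.
Qed.

Lemma chain_uniq l : chain [::] l -> uniq l.
Proof.
elim/last_ind: l => [//|l z IH]; rewrite chain_rcons => /andP[cl az].
rewrite rcons_uniq IH // andbT; case: z az => r c /addableP[/= cE _].
by rewrite chain_mem // -cE ltnn.
Qed.

(** The first free box of line [i], which is a column if [t] and a row
    otherwise. *)
Definition lend (t : bool) (i : nat) (D : seq box) : box :=
  if t then (clen D i, i) else (i, rlen D i).

Definition push (t : bool) D (z : box) : box :=
  lend t (if t then z.2.+1 else z.1.+1) D.

(** Fomin's local rule.  If [D] grows by the box [y] because of an entry of the
    tableau and by the box [z] because of an insertion, then in the new tableau
    the entry accounts for the first component, and the insertion has added the
    second one.  When the two compete for the same box, the entry is bumped. *)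
Definition loc (t : bool) D (z y : box) : box * box :=
  if y == z then (push t D z, push t D z) else (y, z).

Lemma loc_hit t D z : loc t D z z = (push t D z, push t D z).
Proof. by rewrite /loc eqxx. Qed.

Lemma loc_miss t D z y : y != z -> loc t D z y = (y, z).
Proof. by rewrite /loc => /negPf->. Qed.

Lemma lend_perm t i D D' : perm_eq D D' -> lend t i D = lend t i D'.
Proof.
by move=> pD; rewrite /lend (rlen_perm _ _ pD) (clen_perm _ _ pD).
Qed.

Lemma push_perm t D D' z : perm_eq D D' -> push t D z = push t D' z.
Proof. exact: lend_perm. Qed.

Lemma loc_perm t D D' z y : perm_eq D D' -> loc t D z y = loc t D' z y.
Proof. by move=> pD; rewrite /loc (push_perm _ _ _ _ pD). Qed.

Lemma addable_start t D : ideal D -> addable D (lend t 0 D).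
Proof.
move=> iD; apply/addableP; rewrite /lend; case: t => /=; split=> //.
  have := iD (clen D 0) 0; lia.
have := iD 0 (rlen D 0); lia.
Qed.

(** Once [z] is added, the next line is strictly shorter than the line of [z]. *)
Lemma addable_push t D z : ideal D -> addable D z ->
  addable (z :: D) (push t D z).
Proof.
case: z => r c iD /addableP[/= cE rE]; apply/addableP.
rewrite /push /lend; case: t => /=; rewrite rlen_cons clen_cons /=; split.
- have := iD (clen D c.+1) c; have := iD (clen D c.+1) c.+1.
  have := clen_noninc D c c.+1 iD.
  have [<-|] := eqVneq r (clen D c.+1); lia.
- lia.
- lia.
- have := iD r (rlen D r.+1); have := iD r.+1 (rlen D r.+1).
  have := rlen_noninc D r r.+1 iD.
  have [<-|] := eqVneq c (rlen D r.+1); lia.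
Qed.

Lemma addable_neq D y z : addable D y -> addable D z -> y != z ->
  (y.1 != z.1) /\ (y.2 != z.2).
Proof.
case: y z => [yr yc] [zr zc] /addableP[/= y2 y1] /addableP[/= z2 z1] yz.
split; apply: contraNneq yz => e; rewrite xpair_eqE e eqxx ?andbT.
  by rewrite y2 z2 e eqxx.
by rewrite y1 z1 e eqxx.
Qed.

Lemma addable_swap D y z : addable D y -> addable D z -> y != z ->
  addable (y :: D) z.
Proof.
move=> ay az yz; have [h1 h2] := addable_neq _ _ _ ay az yz.
move/addableP: az => [z2 z1]; apply/addableP; rewrite rlen_cons clen_cons.
by split; lia.
Qed.

Lemma loc_fst_addable t D z y : ideal D -> addable D z -> addable D y ->
  addable (z :: D) (loc t D z y).1.
Proof.
move=> iD az ay; rewrite /loc; have [yz|yz] := eqVneq y z => /=.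
  exact: addable_push.
by apply: addable_swap; rewrite // eq_sym.
Qed.

Lemma loc_snd_addable t D z y : ideal D -> addable D z -> addable D y ->
  addable (y :: D) (loc t D z y).2.
Proof.
move=> iD az ay; rewrite /loc; have [->|yz] := eqVneq y z => /=.
  exact: addable_push.
exact: addable_swap.
Qed.

Lemma loc_cons_perm t D z y :
  perm_eq [:: (loc t D z y).1, z & D] [:: (loc t D z y).2, y & D].
Proof.
rewrite /loc; have [->|yz] := eqVneq y z => //=.
by apply/permP => a /=; lia.
Qed.

Lemma locC t D z y : loc t D y z = ((loc t D z y).2, (loc t D z y).1).
Proof. by rewrite /loc eq_sym; have [->|] := eqVneq y z. Qed.

(** The second of two boxes added in succession cannot lie both above and to the
    right of the first one, since the box below it would then be missing. *)
Lemma turnE D y y2 : ideal D -> addable D y -> addable (y :: D) y2 ->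
  (y.1 < y2.1) = ~~ (y.2 < y2.2).
Proof.
case: y y2 => [r c] [r2 c2] iD /addableP[/= a1 a2] /addableP[/= b1 _].
move: b1 (iD r2 c); rewrite rlen_cons /=.
by have [<-|] := eqVneq r r2; lia.
Qed.

(** The key fact of the whole development: the turn between two consecutive
    boxes survives the passage of an insertion, whichever way entries are
    pushed. *)
Lemma loc_turn t D z y y2 : ideal D -> addable D z -> addable D y ->
    addable (y :: D) y2 ->
  ((loc t D z y).1.2 < (loc t (y :: D) (loc t D z y).2 y2).1.2)
    = (y.2 < y2.2).
Proof.
move=> iD az ay ay2; have it := turnE _ _ _ iD ay ay2.
have [yz|yz] := eqVneq y z.
- subst z; rewrite loc_hit /=; have [->|] := eqVneq y2 (push t D y).
  + rewrite loc_hit /push /lend; case: t => /=; first by lia.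
    by rewrite !rlen_cons; have := rlen_noninc D _ _ iD (leqnSn y.1);
      have := rlen_noninc D _ _ iD (leqnSn y.1.+1); move/addableP: ay; lia.
  move=> ne; rewrite loc_miss //.
  case: y y2 ne ay ay2 it {az} => [r c] [pr pc] ne /addableP[/= cE rE].
  move/addableP; rewrite rlen_cons clen_cons /= => -[pcE prE] it.
  move: ne; rewrite /push /lend; case: t; rewrite xpair_eqE /=.
  + have [e|ne] := eqVneq pc c.+1; last by lia.
    by move: prE; rewrite e; lia.
  + have [e|ne _] := eqVneq pr r.+1; first by move: pcE; rewrite e; lia.
    have := rlen_noninc D _ _ iD (leqnSn r).
    have : r.+1 <= pr -> rlen D pr <= rlen D r.+1.
      by move=> h; apply: rlen_noninc.
    lia.
- rewrite (loc_miss t D) //=; have [y2z|ne] := eqVneq y2 z; last by rewrite loc_miss.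
  subst y2; rewrite loc_hit; have [n1 n2] := addable_neq _ _ _ ay az yz.
  case: y z ay az {ay2} n1 n2 it yz => [yr yc] [r c] /= ay az n1 n2 it _.
  rewrite /push /lend; case: t => /=; first lia.
  rewrite rlen_cons /=.
  have := iD r.+1 yc; move/addableP: ay => [/= ycE yrE].
  by have [e|] := eqVneq yr r.+1; [rewrite -e|]; lia.
Qed.

(** A fresh insertion enters the first row at its far right, or the first
    column at its top; this lemma and the next record the turn it makes with an
    entry placed just before it, respectively just after it. *)
Lemma start_after_turn t D y : ideal D -> addable D y ->
  (y.2 < (lend t 0 (y :: D)).2) = ~~ t.
Proof.
case: y => r c iD /addableP[/= cE rE]; rewrite /lend; case: t => //=.
rewrite rlen_cons /=; have := iD 0 c.
by move: cE; have [->|] := eqVneq r 0; lia.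
Qed.

Lemma start_before_turn t D y : ideal D -> addable D y ->
  ((lend t 0 D).2 < (loc t D (lend t 0 D) y).1.2) = t.
Proof.
move=> iD ay; rewrite /loc; have [e|ne] := eqVneq y _.
  rewrite /push /lend; case: t e => //= e.
  have := rlen_noninc D 0 1 iD; lia.
have as0 := addable_start t D iD; have [_ n2] := addable_neq _ _ _ ay as0 ne.
move/addableP: ay n2 => [yc yr]; rewrite /lend.
case: t {as0 ne} => /=; first lia.
by have := rlen_noninc D 0 y.1 iD; lia.
Qed.

(** * The last-letter order is total *)

Lemma llt_seq_irr d (T : orderType d) : irreflexive (@llt_seq d T).
Proof. by elim=> [//|u s IH] /=; rewrite Order.POrderTheory.ltxx eqxx IH. Qed.

Lemma llt_seq_trans d (T : orderType d) : transitive (@llt_seq d T).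
Proof.
elim=> [|v t IH] [|u s] [|w r] //=.
case/orP=> [uv|/andP[/eqP-> st]] /orP[vw|/andP[/eqP e tr]].
- by rewrite (Order.POrderTheory.lt_trans uv vw).
- by rewrite -e uv.
- by rewrite vw.
- by rewrite -e eqxx (IH _ _ st tr) orbT.
Qed.

Lemma llt_seq_total d (T : orderType d) s t :
  [|| s == t, @llt_seq d T s t | llt_seq t s].
Proof.
elim: s t => [|u s IH] [|v t] //=; rewrite eqseq_cons.
by case: Order.TotalTheory.ltgtP => //= _; rewrite IH.
Qed.

Lemma desc_inj d (T : orderType d) : injective (@desc d T).
Proof.
move=> S R e; rewrite -(seq_mset_id S) -(seq_mset_id R).
by apply/eq_seq_msetP; rewrite -(perm_sort >=%O) -/(desc S) e perm_sort.
Qed.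

Lemma llt_irr (S : block) : llt S S = false.
Proof. exact: llt_seq_irr. Qed.

Lemma llt_trans (R S U : block) : llt S R -> llt R U -> llt S U.
Proof. exact: llt_seq_trans. Qed.

Lemma lltNle (S R : block) : llt S R = ~~ lle R S.
Proof.
rewrite /lle negb_or; have [->|ne] := eqVneq R S; first by rewrite llt_irr.
have := llt_seq_total _ _ (desc S) (desc R).
rewrite (inj_eq (@desc_inj _ _)) eq_sym (negPf ne) /= -/(llt S R) -/(llt R S).
case/orP=> sr; rewrite sr.
  by apply/esym/negP => rs; have := llt_trans _ _ _ sr rs; rewrite llt_irr.
by apply/negP => rs; have := llt_trans _ _ _ sr rs; rewrite llt_irr.
Qed.

Lemma lle_refl : reflexive (lle : rel block).
Proof. by move=> S; rewrite /lle eqxx. Qed.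

Lemma lle_total : total (lle : rel block).
Proof.
move=> S R; case: (boolP (lle R S)); rewrite ?orbT // -lltNle => h.
by rewrite /lle h orbT.
Qed.

Lemma llt_lle (S R : block) : llt S R -> lle S R.
Proof. by rewrite /lle => ->; rewrite orbT. Qed.

Lemma lle_lt_trans (S R U : block) : lle S R -> llt R U -> llt S U.
Proof. by case/orP=> [/eqP->//|]; apply: llt_trans. Qed.

Lemma lt_lle_trans (S R U : block) : llt S R -> lle R U -> llt S U.
Proof. by move=> h /orP[/eqP<-//|]; apply: llt_trans. Qed.

Lemma lle_trans : transitive (lle : rel block).
Proof.
move=> R S U /orP[/eqP->//|h] h2.
by apply: llt_lle; exact: lt_lle_trans h h2.
Qed.

Lemma lle_anti : antisymmetric (lle : rel block).
Proof.
move=> S R /andP[h1 /orP[/eqP//|h2]].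
by have := lle_lt_trans _ _ _ h1 h2; rewrite llt_irr.
Qed.

Lemma lle0 (S : block) : lle mset0 S.
Proof. by rewrite /lle llt0m eq_sym; case: eqP. Qed.

(** * Insertion, one entry at a time *)

Notation entry := (block * box)%type.

(** A semistandard tableau is encoded as the list of its entries with their
    boxes, in this order: equal even entries are read from left to right, equal
    odd ones from bottom to top. *)
Definition lt_entry (x y : entry) : bool :=
  llt x.1 y.1 ||
  (x.1 == y.1) && (if eps x.1 then x.2.1 < y.2.1 else x.2.2 < y.2.2).

Lemma lt_entry_irr : irreflexive lt_entry.
Proof.
by move=> x; rewrite /lt_entry llt_irr eqxx /=; case: ifP; rewrite ltnn.
Qed.

Lemma lt_entry_trans : transitive lt_entry.
Proof.
move=> y x z; rewrite /lt_entry.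
case/orP=> [h1|/andP[/eqP e1 h1]] /orP[h2|/andP[/eqP e2 h2]].
- by rewrite (llt_trans _ _ _ h1 h2).
- by rewrite -e2 h1.
- by rewrite e1 h2.
- rewrite e1 e2 eqxx llt_irr /=; move: h1 h2; rewrite e1 e2.
  by case: ifP => _; apply: ltn_trans.
Qed.

Lemma lt_entry_lle x y : lt_entry x y -> lle x.1 y.1.
Proof. by case/orP=> [/llt_lle//|/andP[/eqP-> _]]; exact: lle_refl. Qed.

Lemma lt_entry_turn D v y y2 : ideal D -> addable D y -> addable (y :: D) y2 ->
  lt_entry (v, y) (v, y2) = (y.2 < y2.2) (+) eps v.
Proof.
move=> iD ay ay2; rewrite /lt_entry llt_irr eqxx /= (turnE D) //.
by case: (eps v); rewrite ?addbF ?addbT.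
Qed.

Definition boxes (L : seq entry) : seq box := [seq x.2 | x <- L].

(** Columns if true, rows if false. *)
Definition line_type (e : bool) (v : block) : bool := eps v (+) e.

(** Whether [e]-insertion treats a new [b] as smaller than a present [v]; the
    two modes only differ for [b = v]. *)
Definition before (e : bool) (b v : block) : bool :=
  if e then lle b v else llt b v.

(** The local rule applied all along a list of entries [L], with [z] the box that
    the insertion has added so far.  Lists grow at their end, so that the same
    relation can be run backwards from the last entry.  The parameter [chk]
    switches on the requirement that [b] be placed in order. *)
Inductive ins (chk : bool) (e : bool) (b : block) :
    seq entry -> seq entry -> box -> Prop :=
| ins_start L :
    chain [::] (boxes L) ->
    chk ==> all (fun x => ~~ before e b x.1) L ->
    ins chk e b L (rcons L (b, lend (line_type e b) 0 (boxes L)))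
      (lend (line_type e b) 0 (boxes L))
| ins_step L L' z v y :
    ins chk e b L L' z ->
    addable (boxes L) y ->
    chk ==> before e b v ->
    ins chk e b (rcons L (v, y))
      (rcons L' (v, (loc (line_type e v) (boxes L) z y).1))
      (loc (line_type e v) (boxes L) z y).2.

Lemma ins_step_loc chk e b L L' z v y y' z' : ins chk e b L L' z ->
  addable (boxes L) y -> chk ==> before e b v ->
  loc (line_type e v) (boxes L) z y = (y', z') ->
  ins chk e b (rcons L (v, y)) (rcons L' (v, y')) z'.
Proof.
by move=> i ay bv E; have := ins_step _ _ _ _ _ _ _ _ i ay bv; rewrite E.
Qed.

Lemma boxes_rcons L x : boxes (rcons L x) = rcons (boxes L) x.2.
Proof. exact: map_rcons. Qed.

Lemma perm_rcons_cons (T : eqType) (s s' : seq T) x y :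
  perm_eq s (x :: s') -> perm_eq (rcons s y) [:: y, x & s'].
Proof. by move=> h; rewrite perm_rcons perm_cons. Qed.

Lemma ins_shape chk e b L L' z : ins chk e b L L' z ->
  [/\ chain [::] (boxes L), chain [::] (boxes L'), addable (boxes L) z,
      perm_eq (boxes L') (z :: boxes L) &
      perm_eq [seq x.1 | x <- L'] (b :: [seq x.1 | x <- L])].
Proof.
elim=> {L L' z} [L cL _|L L' z v y _ [cL cL' az pb pv] ay _].
  rewrite boxes_rcons chain_rcons cL /= map_rcons /= !perm_rcons.
  by have az := addable_start (line_type e b) _ (chain_ideal _ cL).
have iL := chain_ideal _ cL; rewrite !boxes_rcons !chain_rcons cL cL' ay /=.
rewrite !map_rcons /=; split=> //.
- by rewrite (addable_perm _ _ _ pb) loc_fst_addable.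
- by rewrite (addable_perm _ _ _ (rcons_perm _ _)) loc_snd_addable.
- apply: perm_trans (perm_rcons_cons _ _ _ _ _ pb) _.
  apply: perm_trans (loc_cons_perm _ _ _ _) _.
  by rewrite perm_cons perm_sym perm_rcons.
- apply: perm_trans (perm_rcons_cons _ _ _ _ _ pv) _.
  have -> : [:: v, b & [seq x.1 | x <- L]]
    = [:: v] ++ [:: b] ++ [seq x.1 | x <- L] by [].
  by rewrite perm_catCA /= perm_cons perm_sym perm_rcons.
Qed.

Lemma sorted_rcons2 (T : eqType) (r : rel T) s x y :
  sorted r (rcons (rcons s x) y) = sorted r (rcons s x) && r x y.
Proof. by case: s => [|a s] /=; rewrite ?andbT // rcons_path last_rcons. Qed.

Lemma sorted_rcons_prefix (T : eqType) (r : rel T) s x :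
  sorted r (rcons s x) -> sorted r s.
Proof. by case: s => [//|a s] /=; rewrite rcons_path => /andP[]. Qed.

Lemma sorted_rcons_all L x : sorted lt_entry (rcons L x) ->
  all (lt_entry^~ x) L.
Proof.
rewrite (sorted_pairwise lt_entry_trans) -cats1 pairwise_cat.
by rewrite allrel1r => /andP[].
Qed.

(** This is [loc_turn] if the entries are equal; otherwise they compare by their
    values alone. *)
Lemma ins_step_lt chk e b L L' z u x v y : ins chk e b L L' z ->
  addable (boxes L) x -> addable (rcons (boxes L) x) y ->
  lt_entry (u, (loc (line_type e u) (boxes L) z x).1)
    (v, (loc (line_type e v) (rcons (boxes L) x)
           (loc (line_type e u) (boxes L) z x).2 y).1)
  = lt_entry (u, x) (v, y).
Proof.
move=> /ins_shape[cL _ az _ _] ax ay; have iL := chain_ideal _ cL.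
have [e1|ne] := eqVneq u v; last by rewrite /lt_entry /= (negPf ne).
subst v; have pL := rcons_perm (boxes L) x.
have ay' : addable (x :: boxes L) y by rewrite -(addable_perm _ _ _ pL).
have a1 := loc_fst_addable (line_type e u) _ _ _ iL az ax.
have a2 := loc_snd_addable (line_type e u) _ _ _ iL az ax.
rewrite (loc_perm _ _ _ _ _ pL) (lt_entry_turn (boxes L) _ x y) //.
rewrite (lt_entry_turn (z :: boxes L)) //; first by rewrite loc_turn.
  exact: ideal_cons.
rewrite (addable_perm _ _ _ (loc_cons_perm _ _ _ _)).
by apply: loc_fst_addable => //; apply: ideal_cons.
Qed.

(** The turn that a new [b] makes with an equal entry right after it, or (next
    lemma) right before it, is the required one exactly in the mode which
    inserts [b] on that side. *)
Lemma ins_start_lt e b L y : chain [::] (boxes L) -> addable (boxes L) y ->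
  lt_entry (b, lend (line_type e b) 0 (boxes L))
    (b, (loc (line_type e b) (boxes L) (lend (line_type e b) 0 (boxes L)) y).1)
  = e.
Proof.
move=> /chain_ideal iL ay.
have as0 := addable_start (line_type e b) _ iL.
rewrite (lt_entry_turn (boxes L)) //; last exact: loc_fst_addable.
by rewrite start_before_turn // /line_type; case: (eps b); case: (e).
Qed.

Lemma ins_end_lt e b L x : chain [::] (boxes L) -> addable (boxes L) x ->
  lt_entry (b, x) (b, lend (line_type e b) 0 (rcons (boxes L) x)) = ~~ e.
Proof.
move=> /chain_ideal iL ax; rewrite (lend_perm _ _ _ _ (rcons_perm _ _)).
rewrite (lt_entry_turn (boxes L)) //; last first.
  by apply: addable_start; apply: ideal_cons.
by rewrite start_after_turn // /line_type; case: (eps b); case: (e).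
Qed.

Lemma beforeNlle e b v : ~~ before e b v -> lle v b.
Proof.
rewrite /before; case: e; last by rewrite lltNle negbK.
by rewrite -lltNle; apply: llt_lle.
Qed.

Lemma before_lle e b v : before e b v -> lle b v.
Proof. by case: e => //=; apply: llt_lle. Qed.

(** Equal entries keep their turns by [ins_step_lt], and [b] makes the required
    turn with an equal neighbour by the two lemmas above. *)
Lemma ins_sorted e b L L' z : ins true e b L L' z ->
  sorted lt_entry L -> sorted lt_entry L'.
Proof.
elim=> {L L' z} [L cL /= aL sL|L L' z v y iLL' IH ay /= bv sL].
- case/lastP: L cL aL sL => [//|L [u x]].
  rewrite boxes_rcons chain_rcons => /andP[cL ax].
  rewrite all_rcons => /andP[/= ub _] sL; rewrite sorted_rcons2 sL /=.
  have [e1|ne] := eqVneq u b; last first.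
    by rewrite /lt_entry /=; case/orP: (beforeNlle _ _ _ ub) ne => [->|->].
  subst u; rewrite ins_end_lt //; move: ub.
  by rewrite /before; case: (e) => //; rewrite lle_refl.
- have sL0 := sorted_rcons_prefix _ _ _ _ sL.
  have {IH sL0} := IH sL0.
  case: iLL' ay sL => {L L' z} [L cL /= _ ay _ sL'|L L' z u x iLL' ax _ ay].
    rewrite sorted_rcons2 sL' /=; have [e1|ne] := eqVneq b v.
      subst v; rewrite ins_start_lt //; move: bv.
      by rewrite /before; case: (e) => //; rewrite llt_irr.
    by rewrite /lt_entry /=; case/orP: (before_lle _ _ _ bv) ne => [->|->].
  rewrite boxes_rcons in ay; rewrite sorted_rcons2 => /andP[_ luv].
  rewrite sorted_rcons2 => -> /=; rewrite boxes_rcons.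
  by rewrite (ins_step_lt _ _ _ _ _ _ _ _ _ _ iLL').
Qed.

(** Order of the result forces [b] to have been placed in order: an equal entry
    on the wrong side of [b] would make a wrong turn. *)
Lemma ins_sorted_rev e b L L' z : ins false e b L L' z ->
  sorted lt_entry L' -> sorted lt_entry L /\ ins true e b L L' z.
Proof.
elim=> {L L' z} [L cL _ sL'|L L' z v y iLL' IH ay _ sL'].
- split; first exact: sorted_rcons_prefix sL'.
  apply: ins_start => //=; apply/allP => -[u x] uxL.
  have /allP/(_ _ uxL) := sorted_rcons_all _ _ sL'.
  rewrite /before /lt_entry /line_type /lend /=.
  case: (e) => /=; last first.
    case/orP=> [/llt_lle|/andP[/eqP-> _]]; rewrite lltNle negbK //.
    exact: lle_refl.
  rewrite -lltNle => /orP[//|/andP[/eqP->]].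
  by case: (eps b).
- have [sL iLL't] := IH (sorted_rcons_prefix _ _ _ _ sL').
  have [bv lv] : before e b v /\ (forall u x L0, L = rcons L0 (u, x) ->
      lt_entry (u, x) (v, y)); last first.
    split; last exact: ins_step.
    case/lastP: L sL lv {IH iLL' ay sL' iLL't} => [//|L0 [u x]] sL lv.
    by rewrite sorted_rcons2 sL; apply: lv.
  case: iLL't ay sL' sL {IH iLL'} => {L L' z}
    [L cL /= aL ay|L L' z u x iLL' ax /= bu ay].
  + rewrite sorted_rcons2 => /andP[_ lbv] sL.
    have bv : before e b v.
      have [e1|ne] := eqVneq b v; last first.
        move: lbv; rewrite /lt_entry (negPf ne) orbF /before /= => h.
        by case: (e) => //; apply: llt_lle.
      subst v; move: lbv; rewrite ins_start_lt // /before.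
      by move=> ->; apply: lle_refl.
    split=> // u x L0 LE; move: aL; rewrite LE all_rcons => /andP[/= nbu _].
    rewrite /lt_entry /=; move: nbu bv; rewrite /before; case: (e).
      by rewrite -lltNle => h1 h2; rewrite (lt_lle_trans _ _ _ h1 h2).
    by rewrite lltNle negbK => h1 h2; rewrite (lle_lt_trans _ _ _ h1 h2).
  + rewrite boxes_rcons sorted_rcons2 => /andP[_].
    rewrite boxes_rcons in ay.
    rewrite (ins_step_lt _ _ _ _ _ _ _ _ _ _ iLL') // => luv _.
    split; last by move=> u' x' L0 /rcons_inj[_ <- <-].
    have uv := lt_entry_lle _ _ luv; move: bu; rewrite /before; case: (e) => h.
      exact: lle_trans h uv.
    exact: lt_lle_trans h uv.
Qed.

(** The turn between the two new boxes is fixed as soon as both insertions have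
    started, and is then preserved by [loc_turn].  If [b2] goes before [b1], it
    enters line 0 first and then meets [b1]; otherwise it enters line 0 when the
    first insertion already has its box. *)
Lemma ins_turn e b1 b2 L0 L1 L2 z1 z2 :
    ins true e b1 L0 L1 z1 -> ins true e b2 L1 L2 z2 ->
  (z1.2 < z2.2) =
    if before e b2 b1 then line_type e b1 else ~~ line_type e b2.
Proof.
move=> i1 i2; elim: i2 b1 L0 z1 i1 => {L1 L2 z2}.
- move=> L1 cL1 /= aL1 b1 L0 z1 i1.
  have [cL0 _ az pb pv] := ins_shape _ _ _ _ _ _ i1.
  have -> : before e b2 b1 = false.
    have : b1 \in [seq x.1 | x <- L1] by rewrite (perm_mem pv) mem_head.
    by case/mapP=> x xL1 ->; apply/negbTE; move/allP: aL1 => /(_ _ xL1).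
  by rewrite (lend_perm _ _ _ _ pb) start_after_turn //; apply: chain_ideal.
- move=> L1 L2 z2 v y' i2 IH ay' /= b2v b1 L0 z1 i1.
  move L1E: (rcons L1 (v, y')) i1 => M i1.
  case: i1 L1E => {M L0 z1} [L cL /= _ | L L' z w y i1 ay /= b1w].
  + case/rcons_inj=> E vE yE; subst L1 v y'; rewrite b2v.
    have [_ _ az2 _ _] := ins_shape _ _ _ _ _ _ i2.
    by rewrite locC start_before_turn //; apply: chain_ideal.
  + case/rcons_inj=> E vE yE; subst L1 v y'.
    rewrite -(IH _ _ _ i1).
    have [cL cL' az pb _] := ins_shape _ _ _ _ _ _ i1.
    have [_ _ az2 _ _] := ins_shape _ _ _ _ _ _ i2.
    have az2' : addable (z :: boxes L) z2 by rewrite -(addable_perm _ _ _ pb).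
    have := loc_turn (line_type e w) _ _ _ _ (chain_ideal _ cL) ay az az2'.
    rewrite (locC _ _ z y) /= (locC _ (z :: boxes L) z2) /=.
    by rewrite (loc_perm _ _ _ _ _ pb).
Qed.

(** * Insertion is reversible *)

Lemma push_inj t D D2 z z2 : perm_eq (z :: D) (z2 :: D2) ->
    addable D z -> addable D2 z2 ->
  push t D z = push t D2 z2 -> z = z2.
Proof.
move=> pD az az2; move: (clen_perm _ _ pD z.2) (rlen_perm _ _ pD z.1).
rewrite !rlen_cons !clen_cons !eqxx /push /lend.
rewrite [z]surjective_pairing [z2]surjective_pairing.
move/addableP: az => [cE rE]; move/addableP: az2 => [c2E r2E].
case: t => /=.
  by move=> + _ [_ e]; move: r2E; rewrite -e eqxx -rE => <- /addnI->.
by move=> _ + [e _]; move: c2E; rewrite -e eqxx -cE => <- /addnI->.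
Qed.

Lemma loc_inj t D D2 z z2 y y2 : perm_eq (z :: D) (z2 :: D2) ->
    addable D z -> addable D2 z2 ->
  loc t D z y = loc t D2 z2 y2 -> z = z2 /\ y = y2.
Proof.
move=> pD az az2; rewrite /loc.
have [->|ne] := eqVneq y z; have [->|ne2] := eqVneq y2 z2.
- by case=> /(push_inj _ _ _ _ _ pD az az2) ->.
- by case=> e1 e2; case/eqP: ne2; rewrite -e1 -e2.
- by case=> e1 e2; case/eqP: ne; rewrite e1 e2.
- by case=> -> ->.
Qed.

(** Read backwards from the end, the result shows where the insertion started:
    a bumped entry ends in a line of positive index, the inserted one in
    line 0. *)
Lemma ins_inj e b b2 L L2 L' z :
  ins false e b L L' z -> ins false e b2 L2 L' z -> b = b2 /\ L = L2.
Proof.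
have start_push t D K w : lend t 0 D = push t K w -> False.
  by rewrite /push /lend; case: t => -[].
have loc_eq t D w y u : (loc t D w y).1 = u -> (loc t D w y).2 = u ->
    u = push t D w.
  by rewrite /loc; case: eqP => [_ <- //|ne /= e1 e2]; case: ne; rewrite e1 e2.
move=> i1; elim: i1 b2 L2 => {L L' z}.
- move=> L cL _ b2 L2.
  move ME: (rcons _ _) => M; move wE: (lend _ _ _) => w i2.
  case: i2 ME wE => {M w L2}.
    by move=> L2 _ _ /rcons_inj[-> ->].
  move=> L2 K w v y i2 ay _ /rcons_inj[_ <- e1] e2.
  by have := loc_eq _ _ _ _ _ (esym e1) (esym e2); move/start_push.
- move=> L L' z v y i1 IH ay _ b2 L2.
  move ME: (rcons _ _) => M; move wE: (_.2) => w i2.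
  case: i2 ME wE => {M w L2}.
    move=> L2 cL2 _ /rcons_inj[_ vE e1] e2; subst v.
    by have := loc_eq _ _ _ _ _ e1 e2; move/start_push.
  move=> L2 K w v2 y2 i2 ay2 _ /rcons_inj[E vE e1] e2; subst K v2.
  have [_ _ az pb _] := ins_shape _ _ _ _ _ _ i1.
  have [_ _ az2 pb2 _] := ins_shape _ _ _ _ _ _ i2.
  have pzz : perm_eq (z :: boxes L) (w :: boxes L2).
    by rewrite -(permPl pb) (permPl pb2).
  have : loc (line_type e v) (boxes L) z y = loc (line_type e v) (boxes L2) w y2.
    by rewrite (surjective_pairing (loc _ _ z y)) e1 e2 -surjective_pairing.
  case/(loc_inj _ _ _ _ _ _ _ pzz az az2) => zE yE; subst w y2.
  by have [-> ->] := IH _ _ i2.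
Qed.

(** The local rule can be run backwards when an entry and the insertion share
    their new box [y]: the entry was bumped from the last box of the previous
    line. *)
Lemma bump_origin t D y : ideal D -> addable D y ->
    (if t then y.2 else y.1) != 0 ->
  exists2 z, corner D z & forall D0, perm_eq D (z :: D0) -> push t D0 z = y.
Proof.
case: y => r c iD /addableP[/= cE rE]; case: t => n0.
- exists (clen D c.-1 - 1, c.-1) => /=.
    have := iD (clen D c.-1 - 1) c.-1; have := iD (clen D c.-1 - 1) c.
    have := iD r c.-1; have := iD r c.
    by move=> *; apply/cornerP => /=; split; lia.
  move=> D0 pD; rewrite /push /lend /= prednK ?lt0n //.
  have := clen_perm _ _ pD c; rewrite clen_cons -rE /=.
  by have [|_] := eqVneq c.-1 c; [lia|rewrite add0n => <-].
- exists (r.-1, rlen D r.-1 - 1) => /=.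
    have := iD r.-1 (rlen D r.-1 - 1); have := iD r (rlen D r.-1 - 1).
    have := iD r.-1 c; have := iD r c.
    by move=> *; apply/cornerP => /=; split; lia.
  move=> D0 pD; rewrite /push /lend /= prednK ?lt0n //.
  have := rlen_perm _ _ pD r; rewrite rlen_cons -cE /=.
  by have [|_] := eqVneq r.-1 r; [lia|rewrite add0n => <-].
Qed.

Lemma corner_rcons D y z : corner (rcons D y) z -> addable D y -> z != y ->
  [/\ corner D z, z.1 != y.1 & z.2 != y.2].
Proof.
rewrite (corner_perm _ _ _ (rcons_perm _ _)).
case: y z => [r c] [r2 c2] /cornerP[]; rewrite rlen_cons clen_cons /=.
move=> c2E r2E /addableP[/= cE rE]; rewrite xpair_eqE => ne.
have nr : r2 != r.
  apply: contraNneq ne => e; move: c2E; rewrite e eqxx -cE => -[->].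
  by rewrite !eqxx.
have nc : c2 != c.
  apply: contraNneq ne => e; move: r2E; rewrite e eqxx -rE => -[->].
  by rewrite !eqxx.
split=> //; apply/cornerP => /=; move: c2E r2E.
by rewrite eq_sym (negPf nr) eq_sym (negPf nc).
Qed.

(** Running the local rule backwards from the last entry: as long as the box [z]
    to be removed is not that of the current entry, both stay; otherwise the
    entry was either bumped there or is the inserted one. *)
Lemma ins_surj e L' z : chain [::] (boxes L') -> corner (boxes L') z ->
  exists b L, ins false e b L L' z.
Proof.
elim/last_ind: L' z => [|L' [v y] IH] z; first by move=> _ /cornerP[].
rewrite boxes_rcons chain_rcons => /andP[cL' ay] cz.
have iL' := chain_ideal _ cL'.
have [zy|ne] := eqVneq z y; last first.
  have [/(IH _ cL')[b [L i1]] n1 n2] := corner_rcons _ _ _ cz ay ne.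
  have [_ _ az pb _] := ins_shape _ _ _ _ _ _ i1; exists b, (rcons L (v, y)).
  have ne' : y != z by rewrite eq_sym.
  apply: ins_step_loc i1 _ _ (loc_miss _ _ _ _ ne') => //.
  move: ay; rewrite (addable_perm _ _ _ pb).
  case/addableP; rewrite rlen_cons clen_cons (negPf n1) (negPf n2) !add0n.
  move=> e1 e2.
  exact/addableP.
subst z; have [l0|ln0] := eqVneq (if line_type e v then y.2 else y.1) 0.
  exists v, L'; have -> : y = lend (line_type e v) 0 (boxes L').
    move/addableP: ay l0; rewrite /lend; case: y {cz} => r c /= [cE rE].
    by case: line_type => e0; rewrite e0 in cE rE *; rewrite -?cE -?rE.
  exact: ins_start.
have [w cw wE] := bump_origin _ _ _ iL' ay ln0.
have [b [L i1]] := IH _ cL' cw.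
have [_ _ az pb _] := ins_shape _ _ _ _ _ _ i1; exists b, (rcons L (v, w)).
apply: ins_step_loc i1 az _ _ => //.
by rewrite loc_hit (wE _ pb).
Qed.

(** * Super RSK as a relation, and its bijectivity *)

(** The order of a biword in which only pairs of even total parity may be
    repeated. *)
Definition pair_ltw (x y : block * block) : bool :=
  pair_lt x y || (x == y) && ~~ (eps x.1 (+) eps x.2).

(** The second list records the new boxes in the order of their creation, so it
    is a growth of shapes by construction; only its order is at stake. *)
Inductive rsk : seq (block * block) -> seq entry -> seq entry -> Prop :=
| rsk_nil : rsk [::] [::] [::]
| rsk_rcons w P Q x P' z : rsk w P Q -> ins true (eps x.1) x.2 P P' z ->
    rsk (rcons w x) P' (rcons Q (x.1, z)).

Lemma rsk_shape w P Q : rsk w P Q ->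
  [/\ chain [::] (boxes P), chain [::] (boxes Q), sorted lt_entry P &
      perm_eq (boxes P) (boxes Q)]
  /\ perm_eq [seq x.1 | x <- P] [seq x.2 | x <- w]
  /\ [seq x.1 | x <- Q] = [seq x.1 | x <- w].
Proof.
elim=> // {w P Q} w P Q x P' z _ [[cP cQ sP pPQ] [pP qQ]] i.
have [_ cP' az pb pv] := ins_shape _ _ _ _ _ _ i.
rewrite boxes_rcons !map_rcons qQ chain_rcons cQ /=; split; last split=> //.
- split=> //; first by rewrite -(addable_perm _ _ _ pPQ).
    exact: ins_sorted i sP.
  rewrite (permPl pb) perm_sym; apply: perm_trans (rcons_perm _ _) _.
  by rewrite perm_cons perm_sym.
- by rewrite (permPl pv) perm_sym perm_rcons perm_cons perm_sym.
Qed.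

Lemma pair_ltw_turn a b1 b2 :
  pair_ltw (a, b1) (a, b2) =
  (if before (eps a) b2 b1 then line_type (eps a) b1
   else ~~ line_type (eps a) b2) (+) eps a.
Proof.
rewrite /pair_ltw /pair_lt /= llt_irr eqxx /= xpair_eqE eqxx /= /line_type.
have [->|ne] := eqVneq b1 b2.
  by rewrite llt_irr /before lle_refl llt_irr; case: (eps a); case: (eps b2).
have E c : before c b2 b1 = llt b2 b1.
  by case: c; rewrite /before /lle // eq_sym (negPf ne).
have E2 : llt b1 b2 = ~~ llt b2 b1.
  by rewrite lltNle /lle eq_sym (negPf ne).
by rewrite E E2; case: (eps a); case: (eps b1); case: (eps b2); case: llt.
Qed.

(** For two consecutive letters with equal first components, the formula of
    [ins_turn] is the order on biwords. *)
Lemma rsk_sorted w P Q : rsk w P Q -> sorted pair_ltw w = sorted lt_entry Q.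
Proof.
elim=> // {w P Q} w P Q x2 P2 z2 r IH i2.
case: r i2 IH => {w P Q} [//|w P Q x1 P1 z1 r i1] i2 IH.
rewrite !sorted_rcons2 IH; congr (_ && _).
have [cP _ az1 pb _] := ins_shape _ _ _ _ _ _ i1.
have [_ _ az2 _ _] := ins_shape _ _ _ _ _ _ i2.
case: x1 x2 i1 i2 {IH r} => [a1 b1] [a2 b2] /= i1 i2.
have [e|ne] := eqVneq a1 a2; last first.
  by rewrite /pair_ltw /pair_lt /lt_entry /= xpair_eqE (negPf ne) !orbF.
subst a2; rewrite pair_ltw_turn -(ins_turn _ _ _ _ _ _ _ _ i1 i2).
rewrite (lt_entry_turn (boxes P)) //; first exact: chain_ideal.
by rewrite -(addable_perm _ _ _ pb).
Qed.

Lemma rsk_inj w w2 P Q : rsk w P Q -> rsk w2 P Q -> w = w2.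
Proof.
move=> r; elim: r w2 => {w P Q} [|w P Q [a b] P' z r IH i] w2 r2.
  move QE: [::] r2 => Q0 r2; case: r2 QE => // {w2 Q0} w P Q x P' z _ _.
  by case: Q.
move QE: (rcons Q _) r2 => Q0 r2.
case: r2 QE i => {w2 Q0 P'} [|w2 P2 Q2 [a2 b2] P' z2 r2 i2].
  by case: Q {IH r}.
case/rcons_inj=> /= qE aE zE i; subst Q2 a2 z2.
have weaken e c L L' u : ins true e c L L' u -> ins false e c L L' u.
  by elim=> *; [apply: ins_start|apply: ins_step].
have [bE PE] :=
  ins_inj _ _ _ _ _ _ _ (weaken _ _ _ _ _ i) (weaken _ _ _ _ _ i2).
by move: bE r2 => /= <-; rewrite -PE => r2; rewrite (IH _ r2).
Qed.

Lemma rsk_surj P Q : chain [::] (boxes P) -> sorted lt_entry P ->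
  chain [::] (boxes Q) -> perm_eq (boxes P) (boxes Q) -> exists w, rsk w P Q.
Proof.
elim/last_ind: Q P => [|Q [a z] IH] P cP sP.
  move=> _ /perm_size/size0nil; case: P {cP sP} => // _.
  by exists [::]; apply: rsk_nil.
rewrite boxes_rcons chain_rcons => /andP[cQ az] pPQ.
have pPz : perm_eq (boxes P) (z :: boxes Q) by rewrite (permPl pPQ) perm_rcons.
have cz : corner (boxes P) z by rewrite (corner_perm _ _ _ pPz) corner_cons.
have [b [P0 i]] := ins_surj (eps a) _ _ cP cz.
have [cP0 _ _ pb _] := ins_shape _ _ _ _ _ _ i.
have [sP0 i'] := ins_sorted_rev _ _ _ _ _ i sP.
have pP0 : perm_eq (boxes P0) (boxes Q).
  by rewrite -(perm_cons z) -(permPl pb).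
have [w rw] := IH _ cP0 sP0 cQ pP0.
by exists (rcons w (a, b)); exact: (rsk_rcons _ _ _ (a, b) _ _ rw i').
Qed.

Lemma ins_det e b L L1 L2 z1 z2 :
  ins true e b L L1 z1 -> ins true e b L L2 z2 -> L1 = L2 /\ z1 = z2.
Proof.
move=> i1; elim: i1 L2 z2 => {L L1 z1}.
  move=> L _ /= aL L2 z2; move LE: L aL => M aM i2.
  case: i2 LE aM => {M L2 z2} [//|L2 L2' z v y _ _ /= bv _].
  by rewrite all_rcons /= bv.
move=> L L' z v y i1 IH ay /= bv L2 z2; move LE: (rcons L _) => M i2.
case: i2 LE => {M L2 z2} [L2 _ /= aL LE|L2 L2' w u x i2 _ _].
  by move: aL; rewrite -LE all_rcons /= bv.
case/rcons_inj=> LE vE yE; subst L2 u x.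
by have [-> ->] := IH _ _ i2.
Qed.

Lemma rsk_det w P P2 Q Q2 : rsk w P Q -> rsk w P2 Q2 -> P = P2 /\ Q = Q2.
Proof.
move=> r; elim: r P2 Q2 => {w P Q} [|w P Q x P' z r IH i] P2 Q2.
  move wE: [::] => w r2; case: r2 wE => // {w P2 Q2} w P2 Q2 x P' z _ _.
  by case: w.
move wE: (rcons w x) => w' r2.
case: r2 wE i => {w' P2 Q2} [|w' P2 Q2 x' P2' z' r2 i2].
  by case: w {r IH}.
case/rcons_inj=> wE xE i; subst w' x'; have [PE QE] := IH _ _ r2.
move: i2; rewrite -PE => i2; have [-> ->] := ins_det _ _ _ _ _ _ _ i i2.
by rewrite QE.
Qed.

(** * Tableaux and their lists of entries *)

Definition get (T : tableau) (z : box) : block := nth mset0 (row T z.1) z.2.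

Definition has_shape (T : tableau) (D : seq box) : Prop :=
  size T = clen D 0 /\ forall r, size (row T r) = rlen D r.

Definition reps (T : tableau) (L : seq entry) : Prop :=
  has_shape T (boxes L) /\ {in L, forall x, get T x.2 = x.1}.

Definition cells (T : tableau) : seq box :=
  [seq (r, c) | r <- iota 0 (size T), c <- iota 0 (size (row T r))].

Lemma has_shape_perm T D D' : perm_eq D D' -> has_shape T D -> has_shape T D'.
Proof.
move=> pD [h1 h2]; split; first by rewrite h1 (clen_perm _ _ pD).
by move=> r; rewrite h2 (rlen_perm _ _ pD).
Qed.

Lemma row_default T r : size T <= r -> row T r = [::].
Proof. exact: nth_default. Qed.

Lemma mem_cells T z : (z \in cells T) = (z.2 < size (row T z.1)).
Proof.
apply/allpairsPdep/idP => [[r [c [_ h ->]]]|].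
  by rewrite mem_iota in h.
move=> h; exists z.1, z.2; rewrite !mem_iota /= add0n; split=> //.
  by rewrite ltnNge; apply: contraTN h => /row_default->.
exact: surjective_pairing.
Qed.

Lemma flatten_cells T : flatten T = [seq get T z | z <- cells T].
Proof.
rewrite /cells map_allpairs /=; congr flatten.
rewrite -{1}(mkseq_nth [::] T) /mkseq; apply: eq_map => r.
by rewrite -/(row T r) -{1}(mkseq_nth mset0 (row T r)).
Qed.

Lemma uniq_cells T : uniq (cells T).
Proof.
apply: allpairs_uniq_dep => [|r _|]; rewrite ?iota_uniq //.
by move=> [r c] [r' c'] _ _ /= [-> ->].
Qed.

Lemma has_shape_cells T D : chain [::] D -> has_shape T D ->
  perm_eq (cells T) D.
Proof.
move=> cD [_ h]; apply: uniq_perm; [exact: uniq_cells|exact: chain_uniq|].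
by move=> [r c]; rewrite mem_cells chain_mem //= h.
Qed.

Lemma reps_flatten T L : chain [::] (boxes L) -> reps T L ->
  perm_eq (flatten T) [seq x.1 | x <- L].
Proof.
move=> cL [sh gL]; rewrite flatten_cells.
apply: perm_trans (perm_map _ (has_shape_cells _ _ cL sh)) _.
rewrite -map_comp; apply/permP => a; congr (count a _).
by apply/eq_in_map => x xL; exact: gL.
Qed.

Lemma reps_nboxes T L : chain [::] (boxes L) -> reps T L -> nboxes T = size L.
Proof.
move=> cL rL; rewrite /nboxes /Defs.shape -size_flatten.
by rewrite (perm_size (reps_flatten _ _ cL rL)) size_map.
Qed.

Lemma tableau_ext (T T' : tableau) : size T = size T' ->
  (forall r, size (row T r) = size (row T' r)) ->
  (forall z, get T z = get T' z) -> T = T'.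
Proof.
move=> e1 e2 e3; apply: (@eq_from_nth _ [::]) => // r _.
apply: (@eq_from_nth _ mset0); first exact: e2.
by move=> c _; exact: (e3 (r, c)).
Qed.

Lemma reps_inj T T' L : chain [::] (boxes L) -> reps T L -> reps T' L -> T = T'.
Proof.
move=> cL [[s1 s2] g] [[s1' s2'] g'].
apply: tableau_ext; [by rewrite s1|by move=> r; rewrite s2 s2'|].
move=> [r c]; case: (ltnP c (rlen (boxes L) r)) => h; last first.
  by rewrite /get !nth_default //= ?s2 ?s2'.
move: h; rewrite -chain_mem // => /mapP[x xL ->].
by rewrite g // g'.
Qed.

Lemma row_put T z S r : row (put T z S) r =
  if r == z.1 then set_nth mset0 (row T r) z.2 S else row T r.
Proof. by rewrite /row /put nth_set_nth /=; case: eqVneq => [->|]. Qed.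

Lemma get_put T z S z' : get (put T z S) z' = if z' == z then S else get T z'.
Proof.
rewrite /get row_put; case: z z' => [r c] [r' c'] /=; rewrite xpair_eqE.
by have [->|] := eqVneq r' r => //=; rewrite nth_set_nth.
Qed.

Lemma put_shape_new T D z S : ideal D -> has_shape T D -> addable D z ->
  has_shape (put T z S) (z :: D).
Proof.
case: z => r c iD [s1 s2] /addableP[/= cE rE]; split.
  rewrite size_set_nth s1 clen_cons /=; have := iD r 0; rewrite -cE.
  by move: rE; have [->|] := eqVneq c 0; lia.
move=> r'; rewrite row_put rlen_cons /= eq_sym; case: eqVneq => [<-|_].
  by rewrite size_set_nth s2 /=; lia.
by rewrite s2.
Qed.

Lemma put_shape_old T D z S : ideal D -> has_shape T D -> z.2 < rlen D z.1 ->
  has_shape (put T z S) D.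
Proof.
case: z => r c iD [s1 s2] /= zD; split.
  by rewrite size_set_nth s1 /=; have := iD r 0; lia.
move=> r'; rewrite row_put /=; case: eqVneq => [->|_]; last by rewrite s2.
by rewrite size_set_nth s2 /=; lia.
Qed.

Lemma filter_take (A : Type) (x0 : A) (a : pred A) s n :
  (forall i, i < size s -> a (nth x0 s i) = (i < n)) -> filter a s = take n s.
Proof.
elim: s n => [//|x s IH] [|n] h; rewrite /= (h 0) //=.
  by rewrite (IH 0) ?take0 // => i is_; rewrite (h i.+1).
by rewrite (IH n) // => i is_; rewrite (h i.+1).
Qed.

Lemma columnE T D c : ideal D -> has_shape T D ->
  column T c = [seq get T (r, c) | r <- iota 0 (clen D c)].
Proof.
move=> iD [s1 s2]; rewrite /column (filter_take _ [::] _ _ (clen D c)).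
  have sz : clen D c <= size T by rewrite s1; apply: clen_noninc.
  apply: (@eq_from_nth _ mset0).
    by rewrite !size_map size_takel // size_iota.
  move=> r; rewrite size_map size_takel // => rc.
  rewrite (nth_map [::]) ?size_takel // nth_take //.
  by rewrite (nth_map 0) ?size_iota // nth_iota.
by move=> r rT; rewrite -/(row T r) s2 iD.
Qed.

(** Rows and columns are treated alike through the following three notions. *)
Definition line (t : bool) (T : tableau) i :=
  if t then column T i else row T i.
Definition cell (t : bool) (i j : nat) : box := if t then (j, i) else (i, j).
Definition llen (t : bool) D i := if t then clen D i else rlen D i.

Lemma lendE t i D : lend t i D = cell t i (llen t D i).
Proof. by case: t. Qed.

Lemma size_line t T D i : ideal D -> has_shape T D ->
  size (line t T i) = llen t D i.
Proof.
move=> iD sT; case: t => /=; last by case: sT.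
by rewrite (columnE _ D) // size_map size_iota.
Qed.

Lemma nth_line t T D i j : ideal D -> has_shape T D -> j < llen t D i ->
  nth mset0 (line t T i) j = get T (cell t i j).
Proof.
move=> iD sT; case: t => //= jl.
by rewrite (columnE _ D) // (nth_map 0) ?size_iota // nth_iota.
Qed.

Lemma llen_cell t D i j : ideal D ->
  (j < llen t D i) = ((cell t i j).2 < rlen D (cell t i j).1).
Proof. by move=> iD; case: t => //=; rewrite iD. Qed.

Lemma find_unique (A : Type) (x0 : A) (a : pred A) s p : p <= size s ->
  (forall i, i < p -> ~~ a (nth x0 s i)) -> (p < size s -> a (nth x0 s p)) ->
  find a s = p.
Proof.
move=> ps h1 h2; case: (ltngtP (find a s) p) => // h.
  have := h1 _ h; rewrite nth_find // has_find.
  exact: leq_trans h ps.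
have := before_find x0 h; rewrite h2 //.
exact: leq_trans h (find_size _ _).
Qed.

(** * The insertion algorithm follows the local rule *)

(** What is left of an insertion run when the content [ov] of [z] has just been
    replaced. *)
Definition bump fuel e T z (ov : option block) : tableau * box :=
  if ov is Some v
  then insert_at fuel e T (if line_type e v then z.2.+1 else z.1.+1) v
  else (T, z).

(** The search through a line stops at the end of that line in the shape of the
    entries [K] already treated: the order of [K] rules out an earlier stop, and
    the last hypothesis a later one. *)
Lemma insert_at_bump fuel e T i S K w D :
    w = lend (line_type e S) i (boxes K) -> chain [::] (boxes K) ->
    sorted lt_entry (rcons K (S, w)) ->
    ideal D -> has_shape T D -> {in K, forall x, get T x.2 = x.1} ->
    (forall r, rlen (boxes K) r <= rlen D r) ->
    (forall c, clen (boxes K) c <= clen D c) ->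
    (w.2 < rlen D w.1 -> before e S (get T w) /\ 0 < fuel) ->
  insert_at fuel e T i S =
  bump fuel.-1 e (put T w S) w
    (if w.2 < rlen D w.1 then Some (get T w) else None).
Proof.
move=> wE cK sK iD sT gK rK cKD hw.
have lineE : (if eps S (+) e then column T i else row T i)
    = line (line_type e S) T i by [].
have iK := chain_ideal _ cK.
have pE : find (before e S) (line (line_type e S) T i)
    = llen (line_type e S) (boxes K) i.
  apply: (@find_unique _ mset0); rewrite ?(size_line _ _ D) //.
  - by rewrite /llen; case: line_type.
  - move=> j jl; rewrite (nth_line _ _ D) //; last first.
      by apply: leq_trans jl _; rewrite /llen; case: line_type.
    have : cell (line_type e S) i j \in boxes K.
      by rewrite [cell _ _ _]surjective_pairing chain_mem // -llen_cell.
    case/mapP=> x xK xE; rewrite xE gK //.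
    have /allP/(_ _ xK) := sorted_rcons_all _ _ sK.
    rewrite /lt_entry -xE /= wE /before /lend /cell /line_type.
    case: (e) => /=; last first.
      case/orP=> [/llt_lle|/andP[/eqP-> _]]; rewrite lltNle negbK //.
      exact: lle_refl.
    rewrite -lltNle => /orP[//|/andP[/eqP->]].
    by case: (eps S); rewrite /= ltnn.
  - by move=> h; move: (h); rewrite (nth_line _ _ D) // llen_cell // -lendE -wE
      => /hw[].
have zE : (if eps S (+) e
    then (find (before e S) (line (line_type e S) T i), i)
    else (i, find (before e S) (line (line_type e S) T i))) = w.
  by rewrite pE wE lendE.
have ltE : (find (before e S) (line (line_type e S) T i)
    < size (line (line_type e S) T i)) = (w.2 < rlen D w.1).
  by rewrite pE (size_line _ _ D) // wE lendE llen_cell.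
have nthE : w.2 < rlen D w.1 ->
    nth mset0 (line (line_type e S) T i)
      (find (before e S) (line (line_type e S) T i)) = get T w.
  by move=> h; rewrite pE (nth_line _ _ D) ?wE ?lendE // llen_cell // -lendE -wE.
case: fuel hw => [|fuel] hw; rewrite /insert_at -/insert_at lineE.
  by case: ltnP hw => [_ /(_ isT)[]//|_ _]; congr pair; rewrite -?zE.
rewrite -/(before e S) in zE ltE nthE *.
rewrite zE ltE; case: (boolP (w.2 < _)) => // h.
by rewrite nthE.
Qed.

Definition content_at (L : seq entry) (z : box) : option block :=
  ohead [seq x.1 | x <- L & x.2 == z].

Lemma content_at_none L z : z \notin boxes L -> content_at L z = None.
Proof.
move=> zL; rewrite /content_at (_ : [seq x <- L | _] = [::]) //.
apply/eqP; rewrite -(negbK (_ == _)) -has_filter; apply: contra zL.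
by case/hasP=> x xL /eqP<-; apply: map_f.
Qed.

Lemma content_at_some L z : z \in boxes L ->
  exists2 u, content_at L z = Some u & (u, z) \in L.
Proof.
elim: L => [//|[v y] L IH]; rewrite /boxes /= inE /content_at /=.
have [<- _|ne /= /IH[u e1 e2]] := eqVneq z y.
  by exists v; rewrite ?mem_head // eqxx.
by exists u; rewrite ?inE ?e2 ?orbT // eq_sym (negPf ne).
Qed.

(** No entry equal to [v] sits where [v] is about to land in 0-insertion: equal
    entries turn the other way. *)
Lemma push_before e D v z u : ideal D -> addable D z ->
  lt_entry (v, z) (u, push (line_type e v) D z) -> before e v u.
Proof.
move=> iD /addableP[cE rE] h.
have vu := lt_entry_lle _ _ h; case: e h vu => // h _.
move: h; rewrite /lt_entry /before /push /lend /line_type addbF /=.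
case/orP=> // /andP[_]; case: (eps v) => /=.
  by have := clen_noninc _ _ _ iD (leqnSn z.2); lia.
by have := rlen_noninc _ _ _ iD (leqnSn z.1); lia.
Qed.

Lemma rlen_cat D D' r : rlen (D ++ D') r = rlen D r + rlen D' r.
Proof. exact: count_cat. Qed.

Lemma clen_cat D D' c : clen (D ++ D') c = clen D c + clen D' c.
Proof. exact: count_cat. Qed.

Lemma addable_cat D D' w : ideal (D ++ D') -> addable D w ->
  (w.2 < rlen (D ++ D') w.1) = false -> addable (D ++ D') w.
Proof.
move=> iD /addableP[cE rE] h; apply/addableP.
by have := iD w.1 w.2; move: h; rewrite rlen_cat clen_cat; lia.
Qed.

Lemma push_end t D z :
  push t D z = lend t (if t then z.2.+1 else z.1.+1) (z :: D).
Proof.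
rewrite /push /lend rlen_cons clen_cons.
by case: t; rewrite (ltn_eqF (ltnSn _)).
Qed.

(** Induction on the entries [L2] still to be visited.  An entry away from the
    current box [z] is passed over by the local rule and not seen by the
    procedure.  An entry at [z] is the one just bumped, and reinserting it is the
    next step of both. *)
Lemma bump_ins e b L2 : forall L1 K z T fuel,
    ins true e b L1 K z ->
    chain [::] (boxes (L1 ++ L2)) -> sorted lt_entry (L1 ++ L2) ->
    all (fun x => before e b x.1) L2 -> size L2 <= fuel.+1 ->
    has_shape T (if z \in boxes L2 then boxes (L1 ++ L2)
                 else z :: boxes (L1 ++ L2)) ->
    {in K, forall x, get T x.2 = x.1} ->
    {in L2, forall x, x.2 != z -> get T x.2 = x.1} ->
  exists K' z', [/\ ins true e b (L1 ++ L2) K' z',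
    (bump fuel e T z (content_at L2 z)).2 = z' &
    reps (bump fuel e T z (content_at L2 z)).1 K'].
Proof.
elim: L2 => [|[v y] L2 IH] L1 K z T fuel i cL sL bL2 szL sT gK gL2.
  rewrite cats0 /= in sT *; exists K, z; split=> //; split=> //.
  have [_ _ _ pb _] := ins_shape _ _ _ _ _ _ i.
  by apply: has_shape_perm sT; rewrite perm_sym.
have [cL1 cK az pb _] := ins_shape _ _ _ _ _ _ i.
have iL1 := chain_ideal _ cL1.
have bcat x s : boxes (L1 ++ x :: s) = rcons (boxes L1) x.2 ++ boxes s.
  by rewrite /boxes map_cat /= cat_rcons.
move: (cL); rewrite bcat chain_cat chain_rcons => /andP[/andP[_ ay] _].
have [bv {}bL2] := andP bL2.
have [yz|ne] := eqVneq y z; last first.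
  have i' := ins_step_loc _ _ _ _ _ _ _ _ _ _ i ay bv (loc_miss _ _ _ _ ne).
  have -> : content_at ((v, y) :: L2) z = content_at L2 z.
    by rewrite /content_at /= (negPf ne).
  rewrite -cat_rcons in cL sL sT *.
  apply: IH i' cL sL bL2 _ _ _ _ => //.
  - exact: leq_trans szL.
  - by move: sT; rewrite /boxes /= inE eq_sym (negPf ne).
  - move=> x; rewrite mem_rcons inE => /orP[/eqP->|/gK//].
    by apply: gL2; rewrite ?mem_head.
  - by move=> x xL2; apply: gL2; rewrite inE xL2 orbT.
subst y; rewrite /content_at /= eqxx /=.
set w := push (line_type e v) (boxes L1) z.
have i' : ins true e b (rcons L1 (v, z)) (rcons K (v, w)) w.
  by apply: ins_step_loc i ay bv _; rewrite loc_hit.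
have [cL1' cK' az' pb' _] := ins_shape _ _ _ _ _ _ i'.
rewrite boxes_rcons /= in cL1' az' pb'.
have uK' := chain_uniq _ cK'.
have wK : w \notin boxes K.
  by move: uK'; rewrite boxes_rcons rcons_uniq => /andP[].
set D := boxes (L1 ++ (v, z) :: L2) in sT cL *.
have iD := chain_ideal _ cL.
have pK : perm_eq (boxes K) (rcons (boxes L1) z).
  by rewrite (permPl pb) perm_sym perm_rcons.
have DE : D = rcons (boxes L1) z ++ boxes L2 by rewrite /D bcat.
have {}sT : has_shape T D by move: sT; rewrite /boxes /= mem_head.
have wD : (w \in D) = (w \in boxes L2).
  by rewrite DE mem_cat -(perm_mem pK) (negPf wK).
have wDlt : (w.2 < rlen D w.1) = (w \in boxes L2).
  by rewrite -wD [w]surjective_pairing chain_mem.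
have uniqD := chain_uniq _ cL.
have zw : w != z.
  by apply: contraNneq wK => ->; rewrite (perm_mem pK) mem_rcons mem_head.
have wL2 u : (u, w) \in L2 -> get T w = u.
  by move=> h; rewrite (gL2 (u, w)) // inE h orbT.
have fuel0 : w \in boxes L2 -> 0 < fuel.
  case: (L2) szL => [//|x s] /=; rewrite ltnS => h _.
  exact: leq_ltn_trans h.
rewrite (insert_at_bump fuel e T _ v K w D) //.
- have oE : (if w.2 < rlen D w.1 then Some (get T w) else None)
     = content_at L2 w.
    rewrite wDlt; case: ifP => [h|/negbT/content_at_none->//].
    by have [u -> /wL2->] := content_at_some _ _ h.
  rewrite oE; rewrite -cat_rcons in sL *; apply: IH i' _ _ _ _ _ _ _ => //.
  + by move: cL; rewrite /D -cat_rcons.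
  + by move: szL; rewrite /= ltnS => h; exact: leq_trans h (leqSpred _).
  + rewrite cat_rcons -/D; case: (boolP (w \in boxes L2)) => h.
      by apply: put_shape_old; rewrite // wDlt.
    apply: put_shape_new => //.
    by rewrite DE addable_cat -?DE // ?wDlt ?(negPf h).
  + move=> x; rewrite mem_rcons inE get_put => /orP[/eqP->|xK].
      by rewrite eqxx.
    case: eqVneq => [e1|_]; last exact: gK.
    by move: wK; rewrite -e1 map_f.
  + move=> x xL2 xw; rewrite get_put (negPf xw); apply: gL2.
      by rewrite inE xL2 orbT.
    apply: contraTneq uniqD => e1; rewrite DE cat_uniq.
    suff -> : has (mem (rcons (boxes L1) z)) (boxes L2) by rewrite andbF.
    by apply/hasP; exists x.2; [apply: map_f|rewrite /= e1 mem_rcons mem_head].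
- by rewrite /w push_end; apply: lend_perm; rewrite perm_sym.
- by apply: ins_sorted i' _; move: sL; rewrite -cat_rcons => /cat_sorted2[].
- by move=> r; rewrite DE rlen_cat (rlen_perm _ _ pK) leq_addr.
- by move=> c; rewrite DE clen_cat (clen_perm _ _ pK) leq_addr.
- rewrite wDlt => h; split; last exact: fuel0.
  have [u _ uL2] := content_at_some _ _ h; rewrite (wL2 _ uL2).
  apply: push_before iL1 ay _.
  have /allP : all (lt_entry (v, z)) L2.
    move: sL; rewrite (sorted_pairwise lt_entry_trans) pairwise_cat.
    by case/and3P=> _ _ /= /andP[].
  exact.
Qed.

Lemma before_trans e b u v : before e b u -> lle u v -> before e b v.
Proof.
rewrite /before; case: e => h h'; first exact: lle_trans h h'.
exact: lt_lle_trans h h'.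
Qed.

Lemma split_before e b L : sorted lt_entry L ->
  exists L1 L2, [/\ L = L1 ++ L2, all (fun x => ~~ before e b x.1) L1 &
    all (fun x => before e b x.1) L2].
Proof.
elim: L => [|x L IH] sL; first by exists [::], [::].
case: (boolP (before e b x.1)) => bx.
  exists [::], (x :: L); split=> //=; rewrite bx /=; apply/allP => y yL.
  apply: before_trans bx _; apply: lt_entry_lle.
  move: sL; rewrite (sorted_pairwise lt_entry_trans) /=.
  by case/andP=> /allP h _; apply: h.
have [L1 [L2 [-> h1 h2]]] := IH (path_sorted sL).
by exists (x :: L1), L2; split; rewrite //= bx.
Qed.

Lemma fuel_bound m n : n <= ((m + n).+1 ^ 2).-1.
Proof. by rewrite expnS expn1 -subn1; nia. Qed.

Lemma insertion_ins e b T L :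
    chain [::] (boxes L) -> sorted lt_entry L -> reps T L ->
  exists L' z, [/\ ins true e b L L' z, (insertion e T b).2 = z &
    reps (insertion e T b).1 L'].
Proof.
move=> cL sL rL; have [L1 [L2 [LE aL1 aL2]]] := split_before e b _ sL.
have cL1 : chain [::] (boxes L1).
  by move: cL; rewrite LE /boxes map_cat chain_cat => /andP[].
have i := ins_start true e _ _ cL1 aL1.
have [_ cK az pb _] := ins_shape _ _ _ _ _ _ i.
set w := lend _ _ _ in i az pb cK.
have iL1 := chain_ideal _ cL1; have iL := chain_ideal _ cL.
have [sT gT] := rL.
have DE : boxes L = boxes L1 ++ boxes L2 by rewrite LE /boxes map_cat.
have wL1 : w \notin boxes L1.
  by have := chain_uniq _ cK; rewrite boxes_rcons rcons_uniq => /andP[].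
have wD : (w.2 < rlen (boxes L) w.1) = (w \in boxes L2).
  rewrite -chain_mem // -surjective_pairing DE mem_cat.
  by rewrite (negPf wL1).
have uniqL := chain_uniq _ cL.
have fuelE : size L2 <= ((nboxes T).+1 ^ 2).-1.+1.
  rewrite (reps_nboxes _ _ cL rL) LE size_cat; apply: leqW.
  exact: fuel_bound.
have oE : (if w.2 < rlen (boxes L) w.1 then Some (get T w) else None)
     = content_at L2 w.
  rewrite wD; case: ifP => [h|/negbT/content_at_none->//].
  have [u -> uL2] := content_at_some _ _ h.
  by rewrite (gT (u, w)) // LE mem_cat uL2 orbT.
have insE : insertion e T b =
    bump ((nboxes T).+1 ^ 2).-1 e (put T w b) w (content_at L2 w).
  rewrite -oE; apply: (insert_at_bump _ _ _ _ _ L1) => //.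
  - by apply: ins_sorted i _; move: sL; rewrite LE => /cat_sorted2[].
  - by move=> x xL1; apply: gT; rewrite LE mem_cat xL1.
  - by move=> r; rewrite DE rlen_cat leq_addr.
  - by move=> c; rewrite DE clen_cat leq_addr.
  - rewrite wD => /content_at_some[u _ uL2]; split; last by rewrite expn_gt0.
    rewrite (gT (u, w)) ?LE ?mem_cat ?uL2 ?orbT //.
    by have /allP/(_ _ uL2) := aL2.
rewrite insE LE; apply: bump_ins i _ _ _ _ _ _ _; rewrite -?LE //.
- case: (boolP (w \in boxes L2)) => h.
    by apply: put_shape_old; rewrite // wD.
  apply: put_shape_new => //.
  by rewrite DE addable_cat -?DE // wD (negPf h).
- move=> x; rewrite mem_rcons inE get_put => /orP[/eqP->|xL1].
    by rewrite eqxx.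
  case: eqVneq => [e1|_]; first by move: wL1; rewrite -e1 map_f.
  by apply: gT; rewrite LE mem_cat xL1.
- move=> x xL2 xw; rewrite get_put (negPf xw); apply: gT.
  by rewrite LE mem_cat xL2 orbT.
Qed.

Lemma reps_rcons T L v z : chain [::] (boxes (rcons L (v, z))) -> reps T L ->
  reps (put T z v) (rcons L (v, z)).
Proof.
move=> cL [sT gT]; have uL := chain_uniq _ cL; move: cL uL.
rewrite boxes_rcons chain_rcons rcons_uniq /= => /andP[cL az] /andP[zL _].
split.
  rewrite boxes_rcons; apply: (@has_shape_perm _ (z :: boxes L)).
    by rewrite perm_sym perm_rcons.
  by apply: put_shape_new => //; apply: chain_ideal.
move=> x; rewrite mem_rcons inE get_put => /orP[/eqP->|xL].
  by rewrite eqxx.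
by case: eqVneq => [e1|_]; [move: zL; rewrite -e1 map_f|apply: gT].
Qed.

Lemma sRSK_rsk w : exists P Q,
  [/\ rsk w P Q, reps (sRSK w).1 P & reps (sRSK w).2 Q].
Proof.
elim/last_ind: w => [|w [a b] [P [Q [r rP rQ]]]].
  exists [::], [::]; split; first exact: rsk_nil.
    by split=> //; split=> // r; rewrite /row nth_nil.
  by split=> //; split=> // r; rewrite /row nth_nil.
have [[cP cQ sP _] _] := rsk_shape _ _ _ r.
have [P' [z [i zE rP']]] := insertion_ins (eps a) b _ _ cP sP rP.
have r' := rsk_rcons _ _ _ (a, b) _ _ r i.
exists P', (rcons Q (a, z)); rewrite /sRSK -cats1 foldl_cat /= -/(sRSK w).
have [[_ cQ' _ _] _] := rsk_shape _ _ _ r'.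
rewrite /sRSK_step; case: (sRSK w) rP rQ rP' zE => T U /= rP rQ.
case: (insertion _ _ _) => T' z' /= rP' zE; subst z'; split=> //.
  by rewrite cats1.
exact: reps_rcons.
Qed.

(** * Semistandard tableaux are ordered growths *)

Definition young (T : tableau) : bool :=
  sorted geq (Defs.shape T) && (0 \notin Defs.shape T).

Lemma rlen_unique D r n : uniq D -> (forall c, ((r, c) \in D) = (c < n)) ->
  rlen D r = n.
Proof.
move=> uD h; rewrite /rlen -size_filter -(size_iota 0 n).
rewrite -(size_map (pair r) (iota 0 n)).
apply: perm_size; apply: uniq_perm.
- exact: filter_uniq.
- by rewrite map_inj_uniq ?iota_uniq // => c c' [].
move=> [r' c]; rewrite mem_filter /=; apply/andP/mapP.
  by case=> /eqP-> rc; exists c; rewrite // mem_iota /= -h.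
by case=> c'; rewrite mem_iota /= => c'n [-> ->]; rewrite h eqxx.
Qed.

Lemma clen_unique D c n : uniq D -> (forall r, ((r, c) \in D) = (r < n)) ->
  clen D c = n.
Proof.
move=> uD h; rewrite /clen -size_filter -(size_iota 0 n).
rewrite -(size_map (fun r => (r, c)) (iota 0 n)).
apply: perm_size; apply: uniq_perm.
- exact: filter_uniq.
- by rewrite map_inj_uniq ?iota_uniq // => r r' [].
move=> [r c']; rewrite mem_filter /=; apply/andP/mapP.
  by case=> /eqP-> rc; exists r; rewrite // mem_iota /= -h.
by case=> r'; rewrite mem_iota /= => r'n [-> ->]; rewrite h eqxx.
Qed.

Lemma nth_shape T r : nth 0 (Defs.shape T) r = size (row T r).
Proof.
rewrite /Defs.shape /row; case: (ltnP r (size T)) => h.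
  by rewrite (nth_map [::]).
by rewrite !nth_default ?size_map.
Qed.

Lemma young_noninc T r r' : young T -> r <= r' ->
  size (row T r') <= size (row T r).
Proof.
case/andP=> sT _ rr'; case: (ltnP r' (size T)) => h; last by rewrite row_default.
have geq_trans : transitive geq by move=> a b c /= ? /leq_trans; apply.
have := @sorted_leq_nth _ geq geq_trans leqnn 0 _ sT r r'.
by rewrite !inE !size_map !nth_shape; apply=> //; apply: leq_ltn_trans h.
Qed.

Lemma rlen_cells T r : rlen (cells T) r = size (row T r).
Proof.
by apply: rlen_unique; [exact: uniq_cells|move=> c; rewrite mem_cells].
Qed.

Lemma ideal_cells T : young T -> ideal (cells T).
Proof.
move=> yT r c; rewrite rlen_cells.
pose n := find (fun R => size R <= c) T.
have nE r' : (c < size (row T r')) = (r' < n).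
  case: (ltnP r' n) => h.
    by have := before_find [::] h; rewrite -/(row T r') ltnNge => ->.
  apply/negbTE; rewrite -leqNgt; apply: leq_trans (young_noninc _ _ _ yT h) _.
  case: (ltnP n (size T)) => h2; last by rewrite row_default.
  have := @nth_find _ [::] (fun R => size R <= c) T.
  by rewrite has_find => /(_ h2).
rewrite nE (clen_unique _ _ n) //; first exact: uniq_cells.
by move=> r'; rewrite mem_cells /= nE.
Qed.

Lemma has_shape_young T : young T -> has_shape T (cells T).
Proof.
move=> yT; split; last by move=> r; rewrite rlen_cells.
apply/esym/clen_unique; first exact: uniq_cells.
move=> r; rewrite mem_cells /=; case: (ltnP r (size T)) => h.
  rewrite lt0n; case/andP: yT => _; apply: contra => /eqP <-.
  by rewrite -nth_shape mem_nth // size_map.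
by rewrite row_default.
Qed.

(** When a box is added, the boxes already present in its row are exactly those
    to its left, since those to its right come later; likewise for columns. *)
Lemma chain_of_order l : uniq l ->
    (forall l1 z l2, l = l1 ++ z :: l2 ->
      forall z', z'.1 <= z.1 -> z'.2 <= z.2 -> z' != z -> z' \in l1) ->
  chain [::] l.
Proof.
elim/last_ind: l => [//|l z IH] ul h; rewrite chain_rcons.
move: (ul); rewrite rcons_uniq => /andP[zl ul'].
rewrite IH //=; last first.
  by move=> l1 y l2 lE; apply: (h l1 y (rcons l2 z)); rewrite lE rcons_cat.
have hz := h l z [::]; rewrite -cats1 in hz.
have nz z' : z.1 <= z'.1 -> z.2 <= z'.2 -> (z' \in l) = false.
  move=> h1 h2; apply/negP => z'l; have [e|ne] := eqVneq z z'.
    by move: zl; rewrite e z'l.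
  case: (splitPr z'l) h zl => l1 l2 h; rewrite mem_cat.
  rewrite (h l1 z' (rcons l2 z)) //.
  by rewrite rcons_cat.
case: z {IH h ul zl} hz nz => r c hz nz; apply/addableP; split=> /=; apply/esym.
  apply: rlen_unique => // c'; case: (ltnP c' c) => cc'.
    by apply: hz; rewrite ?xpair_eqE //=; lia.
  exact: nz.
apply: clen_unique => // r'; case: (ltnP r' r) => rr'.
  by apply: hz; rewrite ?xpair_eqE //=; lia.
exact: nz.
Qed.

Lemma count_le1P (A : eqType) (x0 x : A) s :
  count_mem x s <= 1 <->
  forall i j, i < j -> j < size s -> nth x0 s i = x -> nth x0 s j = x -> False.
Proof.
elim: s => [|y s [IH1 IH2]] //=; split.
  move=> cs [|i] [|j] //= ij js.
    move=> e1 e2; move: cs; rewrite e1 eqxx -[in X in X -> _](ltn_add2l 0).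
    have : 0 < count_mem x s by rewrite -has_count has_pred1 -e2 mem_nth.
    by lia.
  by apply: IH1 => //; lia.
move=> h; have [e|ne] := eqVneq y x.
  suff /count_memPn-> : x \notin s by [].
  apply/negP => xs; apply: (h 0 (index x s).+1) => //=.
    by rewrite ltnS index_mem.
  exact: nth_index.
by rewrite add0n; apply: IH2 => i j ij js; apply: (h i.+1 j.+1).
Qed.

Lemma count_le1_inj (A : eqType) (x0 x : A) s i j : count_mem x s <= 1 ->
  i < size s -> j < size s -> nth x0 s i = x -> nth x0 s j = x -> i = j.
Proof.
move=> /(count_le1P _ x0) h is_ js e1 e2; case: (ltngtP i j) => // ij.
  by case: (h _ _ ij js e1 e2).
by case: (h _ _ ij is_ e2 e1).
Qed.

Lemma get_row_le T r c c' : semistandard T -> c <= c' -> c' < size (row T r) ->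
  lle (get T (r, c)) (get T (r, c')).
Proof.
case=> sr _ _ _ cc' c'r.
apply: (sorted_leq_nth lle_trans lle_refl mset0 (sr r)) => //.
exact: leq_ltn_trans c'r.
Qed.

Lemma nth_column T D r c : ideal D -> has_shape T D -> r < clen D c ->
  nth mset0 (column T c) r = get T (r, c).
Proof.
by move=> iD sT rc; rewrite (columnE _ D) // (nth_map 0) ?size_iota // nth_iota.
Qed.

Lemma size_column T D c : ideal D -> has_shape T D ->
  size (column T c) = clen D c.
Proof. by move=> iD sT; rewrite (columnE _ D) // size_map size_iota. Qed.

Lemma get_column_le T D r r' c : ideal D -> has_shape T D -> semistandard T ->
  r <= r' -> r' < clen D c -> lle (get T (r, c)) (get T (r', c)).
Proof.
move=> iD sT [_ sc _ _] rr' r'c.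
have rc := leq_ltn_trans rr' r'c.
rewrite -(nth_column _ D) // -(nth_column _ D r') //.
by apply: (sorted_leq_nth lle_trans lle_refl mset0 (sc c)) => //;
  rewrite inE (size_column _ D).
Qed.

(** Along the row of [z'] up to the column of [z], and then along that column,
    the values weakly increase.  If they are all equal, the repetition rule
    leaves only a row (even values) or only a column (odd values). *)
Lemma semistandard_lt T D z z' : ideal D -> has_shape T D -> semistandard T ->
    mset0 \notin flatten T ->
    z'.1 <= z.1 -> z'.2 <= z.2 -> z' != z -> z.2 < rlen D z.1 ->
  lt_entry (get T z', z') (get T z, z).
Proof.
case: z z' => [r c] [r' c'] /= iD sT ssT n0 rr cc ne zD.
have [s1 s2] := sT.
have rcD : r < clen D c by rewrite -iD.
have r'cD : c < rlen D r' by rewrite iD; apply: leq_ltn_trans rcD.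
have l1 : lle (get T (r', c')) (get T (r', c)).
  by apply: get_row_le; rewrite // s2.
have l2 : lle (get T (r', c)) (get T (r, c)) by apply: (get_column_le _ D).
have [e|neq] := eqVneq (get T (r', c')) (get T (r, c)); last first.
  by rewrite /lt_entry /=; case/orP: (lle_trans _ _ _ l1 l2) neq => [->|->].
have e' : get T (r', c) = get T (r, c).
  by apply: lle_anti; rewrite l2 -e.
have nz : get T (r, c) != mset0.
  apply: contraNneq n0 => <-; apply/flattenP; exists (row T r).
    by apply: mem_nth; rewrite s1; apply: leq_trans rcD _; apply: clen_noninc.
  by apply: mem_nth; rewrite s2.
case: ssT => _ _ ce co; rewrite /lt_entry /= e eqxx /=; apply/orP; right.
case: ifP => ev.
  rewrite ltn_neqAle rr andbT; apply: contraNneq ne => er; subst r'.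
  have -> // : c' = c.
  apply: (count_le1_inj _ mset0 _ _ _ _ (co r _ nz ev)) => //; rewrite s2 //.
  exact: leq_ltn_trans zD.
rewrite ltn_neqAle cc andbT; apply: contraNneq ne => ec; subst c'.
have -> // : r' = r.
apply: (count_le1_inj _ mset0 _ _ _ _ (ce c _ nz (negbT ev))).
- by rewrite (size_column _ D) //; apply: leq_ltn_trans rcD.
- by rewrite (size_column _ D).
- by rewrite (nth_column _ D) // -iD.
- by rewrite (nth_column _ D).
Qed.

Definition le_entry (x y : entry) : bool :=
  llt x.1 y.1 ||
  (x.1 == y.1) && (if eps x.1 then x.2.1 <= y.2.1 else x.2.2 <= y.2.2).

Lemma le_entry_trans : transitive le_entry.
Proof.
move=> y x z; rewrite /le_entry.
case/orP=> [h1|/andP[/eqP e1 h1]] /orP[h2|/andP[/eqP e2 h2]].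
- by rewrite (llt_trans _ _ _ h1 h2).
- by rewrite -e2 h1.
- by rewrite e1 h2.
- rewrite e1 e2 eqxx llt_irr /=; move: h1 h2; rewrite e1 e2.
  by case: ifP => _; apply: leq_trans.
Qed.

Lemma le_entry_total : total le_entry.
Proof.
move=> x y; rewrite /le_entry; have [e|ne] := eqVneq x.1 y.1.
  by rewrite e llt_irr; case: ifP => _; apply: leq_total.
rewrite !orbF.
by have := lle_total x.1 y.1; rewrite /lle (negPf ne) eq_sym (negPf ne).
Qed.

(** The reading order is a strict total order on the entries because equal even
    (odd) entries lie in different columns (rows). *)
Lemma semistandard_entries T : young T -> semistandard T ->
    mset0 \notin flatten T ->
  exists L, [/\ chain [::] (boxes L), sorted lt_entry L & reps T L].
Proof.
move=> yT ssT n0; have iD := ideal_cells _ yT; have sT := has_shape_young _ yT.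
have [_ s2] := sT.
pose L0 : seq entry := [seq (get T z, z) | z <- cells T].
pose L := sort le_entry L0.
have mL x : (x \in L) = (x.2 \in cells T) && (x.1 == get T x.2).
  rewrite mem_sort; apply/mapP/andP => [[z zT ->]|[h /eqP e]] //=.
  by exists x.2; rewrite // -e -surjective_pairing.
have pL : perm_eq (boxes L) (cells T).
  have -> : cells T = boxes L0 by rewrite /boxes -map_comp map_id.
  by apply: perm_map; rewrite perm_sort.
have uL : uniq L by rewrite sort_uniq map_inj_uniq ?uniq_cells // => z z' [].
have pwL : pairwise lt_entry L.
  have : pairwise le_entry L.
    rewrite -(sorted_pairwise le_entry_trans).
    exact: (sort_sorted le_entry_total).
  move: uL; rewrite uniq_pairwise => h1 h2.
  have : pairwise [rel x y | (x != y) && le_entry x y] L.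
    by rewrite pairwise_relI h1.
  apply: (@sub_in_pairwise _ (mem L)) (allss L).
  move=> [v z] [v' z'] zL z'L.
  have /andP[/= zT /eqP vE] : (z \in cells T) && (v == get T z).
    by rewrite -(mL (v, z)).
  have /andP[/= z'T /eqP v'E] : (z' \in cells T) && (v' == get T z').
    by rewrite -(mL (v', z')).
  case/andP=> ne; rewrite /le_entry /lt_entry /=.
  case/orP=> [->//|/andP[/eqP e h]]; rewrite e eqxx /= in h *.
  apply/orP; right.
  have nz : v' != mset0.
    apply: contraNneq n0 => <-; rewrite flatten_cells v'E; exact: map_f.
  rewrite !mem_cells in zT z'T; case: ssT => _ _ ce co.
  move: ne h; rewrite xpair_eqE e eqxx /=.
  case: z z' zT z'T vE v'E zL z'L => [r c] [r' c'] /= zT z'T vE v'E _ _.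
  rewrite xpair_eqE; case: ifP => ev ne h; rewrite ltn_neqAle h andbT.
    apply: contra ne => /eqP er; subst r'; rewrite eqxx /=; apply/eqP.
    by apply: (count_le1_inj _ mset0 _ _ _ _ (co r _ nz ev)); rewrite // -e.
  apply: contra ne => /eqP ec; subst c'; rewrite eqxx andbT; apply/eqP.
  have rD : r < clen (cells T) c by rewrite -iD rlen_cells.
  have r'D : r' < clen (cells T) c by rewrite -iD rlen_cells.
  apply: (count_le1_inj _ mset0 _ _ _ _ (ce c _ nz (negbT ev)));
    rewrite ?(size_column _ (cells T)) ?(nth_column _ (cells T)) //.
  by rewrite -e.
have sL : sorted lt_entry L by rewrite (sorted_pairwise lt_entry_trans).
exists L; split=> //; last first.
  split; first by apply: has_shape_perm sT; rewrite perm_sym.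
  by move=> x; rewrite mL => /andP[_ /eqP].
apply: chain_of_order; first by rewrite (perm_uniq pL) uniq_cells.
move=> l1 z l2 lE z' h1 h2 ne.
have zT : z \in cells T by rewrite -(perm_mem pL) lE mem_cat mem_head orbT.
have zD : z.2 < rlen (cells T) z.1 by rewrite rlen_cells -mem_cells.
have z'T : z' \in cells T.
  rewrite mem_cells s2 iD; apply: leq_ltn_trans h1 _; rewrite -iD.
  exact: leq_ltn_trans h2 zD.
have lt := semistandard_lt _ _ _ _ iD sT ssT n0 h1 h2 ne zD.
have LE : L = take (size l1) L ++ (get T z, z) :: drop (size l1).+1 L.
  have sz : size l1 < size L.
    by rewrite -(size_map (fun x => x.2)) -/(boxes L) lE size_cat /=; lia.
  rewrite -{1}(cat_take_drop (size l1) L) (drop_nth (mset0, z)) //.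
  have zE : (nth (mset0, z) L (size l1)).2 = z.
    rewrite -(nth_map (mset0, z) z (fun x => x.2)) // -/(boxes L) lE.
    by rewrite nth_cat ltnn subnn.
  have [_ /eqP vE] : (nth (mset0, z) L (size l1)).2 \in cells T
      /\ ((nth (mset0, z) L (size l1)).1 == get T (nth (mset0, z) L (size l1)).2).
    by apply/andP; rewrite -mL mem_nth.
  by rewrite [nth _ _ _]surjective_pairing vE zE.
have l1E : l1 = boxes (take (size l1) L).
  by rewrite /boxes map_take -/(boxes L) lE take_size_cat.
have : (get T z', z') \in L by rewrite mL z'T eqxx.
rewrite LE mem_cat inE => /or3P[h|/eqP[_ e]|h].
- by rewrite l1E; apply: (map_f (fun x => x.2) h).
- by rewrite e eqxx in ne.
- move: pwL; rewrite LE pairwise_cat /= => /and3P[_ _ /andP[/allP/(_ _ h) h3 _]].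
  by have := lt_entry_trans _ _ _ h3 lt; rewrite lt_entry_irr.
Qed.

Lemma entries_unique T L L' : chain [::] (boxes L) -> sorted lt_entry L ->
    reps T L -> chain [::] (boxes L') -> sorted lt_entry L' -> reps T L' ->
  L = L'.
Proof.
move=> cL sL rL cL' sL' rL'.
apply: (irr_sorted_eq lt_entry_trans lt_entry_irr) => //.
have mem M : chain [::] (boxes M) -> reps T M ->
    forall x, (x \in M) = (x.2 \in cells T) && (x.1 == get T x.2).
  move=> cM [sM gM] x; rewrite (perm_mem (has_shape_cells _ _ cM sM)).
  apply/idP/andP => [xM|[/mapP[y yM e] /eqP e1]].
    by rewrite (map_f (fun x => x.2) xM) gM.
  suff -> : x = y by [].
  by rewrite [x]surjective_pairing e1 e gM // -surjective_pairing.
by move=> x; rewrite !(mem _ _ _) //; rewrite (mem L').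
Qed.

(** When a box is added, the boxes before it in its row and column are already
    there, so they come earlier in the list. *)
Lemma entries_lt T L z z' : chain [::] (boxes L) -> sorted lt_entry L ->
    reps T L -> z \in boxes L ->
    (forall D, addable D z -> z'.1 = z.1 /\ z'.2 < rlen D z'.1 \/
       z'.2 = z.2 /\ z'.1 < clen D z'.2) ->
  lt_entry (get T z', z') (get T z, z).
Proof.
move=> cL sL [sT gL] /mapP[x xL zE] h.
have xE : (get T z, z) = x by rewrite zE gL // -surjective_pairing.
rewrite xE; move: cL sL gL; case: (splitPr xL) => L1 L2.
rewrite /boxes map_cat /= -cat_rcons -/(boxes _) chain_cat chain_rcons.
case/andP=> /andP[cL1 ax] _ sL gL.
have : z' \in boxes L1.
  rewrite [z']surjective_pairing chain_mem //.
  have iL1 := chain_ideal _ cL1.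
  by rewrite -zE in ax; case: (h _ ax) => -[_] //; rewrite iL1.
case/mapP=> y yL1 ->; rewrite gL ?mem_cat ?yL1 // -surjective_pairing.
move: sL; rewrite (sorted_pairwise lt_entry_trans) pairwise_cat.
by case/and3P=> /allrelP/(_ _ _ yL1 (mem_head _ _)).
Qed.

Lemma entries_row_lt T L r c c' : chain [::] (boxes L) -> sorted lt_entry L ->
    reps T L -> c < c' -> c' < size (row T r) ->
  lt_entry (get T (r, c), (r, c)) (get T (r, c'), (r, c')).
Proof.
move=> cL sL rL cc' c'r; apply: (entries_lt _ _ _ _ cL sL rL).
  by rewrite chain_mem //; case: rL => -[_ <-].
by move=> D /addableP[/= <- _]; left.
Qed.

Lemma entries_column_lt T L r r' c : chain [::] (boxes L) ->
    sorted lt_entry L -> reps T L -> r < r' -> r' < clen (boxes L) c ->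
  lt_entry (get T (r, c), (r, c)) (get T (r', c), (r', c)).
Proof.
move=> cL sL rL rr' r'c; apply: (entries_lt _ _ _ _ cL sL rL).
  by rewrite chain_mem // (chain_ideal _ cL).
by move=> D /addableP[/= _ <-]; right.
Qed.

Lemma entries_young T L : chain [::] (boxes L) -> reps T L -> young T.
Proof.
move=> cL [[s1 s2] _]; have iL := chain_ideal _ cL; apply/andP; split.
  apply/(sortedP 0) => i _; rewrite !nth_shape !s2 /=.
  exact: rlen_noninc.
apply/negP => /(nthP 0)[r]; rewrite size_map s1 => r0; rewrite nth_shape s2.
by move: r0; rewrite -iL; case: rlen.
Qed.

Lemma entries_semistandard T L : chain [::] (boxes L) -> sorted lt_entry L ->
  reps T L -> semistandard T.
Proof.
move=> cL sL rL; have [[s1 s2] gL] := rL; have iL := chain_ideal _ cL.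
have sT : has_shape T (boxes L) by [].
split.
- move=> r; apply/(sortedP mset0) => i ir.
  exact: lt_entry_lle (entries_row_lt _ _ _ _ _ cL sL rL (ltnSn i) ir).
- move=> c; apply/(sortedP mset0) => i.
  rewrite (size_column _ (boxes L)) // => ic.
  rewrite !(nth_column _ (boxes L)) //; last exact: ltnW.
  exact: lt_entry_lle (entries_column_lt _ _ _ _ _ cL sL rL (ltnSn i) ic).
- move=> c S _ eS; apply/(count_le1P _ mset0) => i j ij.
  rewrite (size_column _ (boxes L)) // => jc.
  rewrite !(nth_column _ (boxes L)) //; last exact: ltn_trans jc.
  move=> e1 e2; have := entries_column_lt _ _ _ _ _ cL sL rL ij jc.
  by rewrite e1 e2 /lt_entry llt_irr eqxx (negPf eS) /= ltnn.
- move=> r S _ eS; apply/(count_le1P _ mset0) => i j ij jr e1 e2.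
  have := entries_row_lt _ _ _ _ _ cL sL rL ij jr.
  by rewrite /get /= e1 e2 /lt_entry llt_irr eqxx eS /= ltnn.
Qed.

Local Open Scope mset_scope.
Local Open Scope nat_scope.

(** * Sums of multisets *)

Definition msum (K : choiceType) (s : seq {mset K}) : {mset K} :=
  \big[msetD/mset0]_(B <- s) B.

Lemma msumE (K : choiceType) (s : seq {mset K}) x :
  msum K s x = \sum_(B <- s) B x.
Proof.
rewrite /msum; elim: s => [|B s IH]; first by rewrite !big_nil mset0E.
by rewrite !big_cons msetE2 IH.
Qed.

Lemma msum_perm (K : choiceType) (s s' : seq {mset K}) :
  perm_eq s s' -> msum K s = msum K s'.
Proof. by move=> ps; apply/msetP => x; rewrite !msumE; apply: perm_big. Qed.

Lemma msum_flatten (K : choiceType) (s : seq {mset K}) :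
  perm_eq (msum K s) (flatten [seq enum_mset B | B <- s]).
Proof.
apply/allP => x _; apply/eqP; rewrite /= count_mem_mset msumE.
by elim: s => [|B s IH]; rewrite ?big_nil // big_cons IH /= count_cat
  count_mem_mset.
Qed.

Lemma size_msum (K : choiceType) (s : seq {mset K}) :
  size (msum K s) = \sum_(B <- s) size B.
Proof.
rewrite (perm_size (msum_flatten _ s)) size_flatten /shape -map_comp.
by rewrite sumnE big_map.
Qed.

Lemma size_le_msum (K : choiceType) (s : seq {mset K}) : mset0 \notin s ->
  size s <= size (msum K s).
Proof.
rewrite size_msum; elim: s => [//|B s IH].
rewrite inE negb_or eq_sym -size_mset_eq0 -lt0n big_cons => /andP[B0 /IH].
by rewrite /=; lia.
Qed.

Lemma size_letters k m (a : k.-tuple nat) (b : m.-tuple nat) :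
  size (letters a b) = sumn a + sumn b.
Proof.
have size_msetD (A B : {mset letter}) : size (msetD A B) = size A + size B.
  have := size_msum _ [:: A; B].
  by rewrite /msum !big_cons !big_nil msetD0 addn0.
rewrite /letters size_msetD.
have E l (t : l.-tuple nat) c : size (\big[msetD/mset0]_(i < l)
    msetn (tnth t i) ((c, i.+1) : letter)) = sumn t.
  rewrite sumnE big_tuple.
  have := size_msum _ [seq msetn (tnth t i) ((c, i.+1) : letter) |
    i <- index_enum 'I_l].
  rewrite /msum !big_map => ->.
  by apply: eq_bigr => i _; rewrite enum_msetn size_nseq.
by rewrite !E.
Qed.

(** * Blocks as pairs of blocks *)

Definition join (x : block * block) : {mset symbol} :=
  seq_mset ([seq ((false, l) : symbol) | l <- x.1] ++
            [seq ((true, l) : symbol) | l <- x.2]).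

Definition parts (B : {mset symbol}) : block * block :=
  (plus_part B, minus_part B).

Lemma plus_partE B l : plus_part B l = B (false, l).
Proof.
rewrite /plus_part mset_seqE count_map count_filter.
rewrite -(count_mem_mset (false, l) B).
apply: eq_count => -[u l'] /=; rewrite xpair_eqE.
by case: u; rewrite ?andbF ?andbT.
Qed.

Lemma minus_partE B l : minus_part B l = B (true, l).
Proof.
rewrite /minus_part mset_seqE count_map count_filter.
rewrite -(count_mem_mset (true, l) B).
apply: eq_count => -[u l'] /=; rewrite xpair_eqE.
by case: u; rewrite ?andbF ?andbT.
Qed.

Lemma count_pair (c u : bool) (l : letter) (A : block) :
  count (preim (fun l' => (c, l') : symbol) (pred1 ((u, l) : symbol))) A
  = (c == u) * A l.
Proof.
rewrite -(count_mem_mset l A); have [->|ne] := eqVneq c u.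
  by rewrite mul1n; apply: eq_count => l' /=; rewrite xpair_eqE eqxx.
rewrite mul0n; apply/eqP; rewrite -leqn0 leqNgt -has_count; apply/hasPn.
by move=> l' _; rewrite /= xpair_eqE (negPf ne).
Qed.

Lemma joinE x u l : join x (u, l) = if u then x.2 l else x.1 l.
Proof.
rewrite /join mset_seqE count_cat !count_map !count_pair.
by case: u; rewrite mul1n mul0n ?addn0.
Qed.

Lemma plus_join x : plus_part (join x) = x.1.
Proof. by apply/msetP => l; rewrite plus_partE joinE. Qed.

Lemma minus_join x : minus_part (join x) = x.2.
Proof. by apply/msetP => l; rewrite minus_partE joinE. Qed.

Lemma joinK : cancel join parts.
Proof. by move=> [x y]; rewrite /parts plus_join minus_join. Qed.

Lemma partsK : cancel parts join.
Proof.
move=> B; apply/msetP => -[u l]; rewrite joinE /=.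
by case: u; rewrite ?minus_partE ?plus_partE.
Qed.

Lemma join0 : join (mset0, mset0) = mset0.
Proof. by apply/msetP => -[u l]; rewrite joinE !mset0E; case: u. Qed.

Lemma has_underlinedE (B : {mset symbol}) :
  has underlined B = (minus_part B != mset0).
Proof.
rewrite /minus_part -size_mset_eq0 (perm_size (perm_eq_seq_mset _)) size_map.
by rewrite size_filter has_count lt0n.
Qed.

Lemma all_underlinedE (B : {mset symbol}) :
  all underlined B = (plus_part B == mset0).
Proof.
rewrite /plus_part -size_mset_eq0 (perm_size (perm_eq_seq_mset _)) size_map.
by rewrite size_filter -leqn0 leqNgt -has_count has_predC negbK.
Qed.

Lemma propagatingE x :
  propagating (join x) = (x.1 != mset0) && (x.2 != mset0).
Proof.
by rewrite /propagating has_underlinedE all_underlinedE plus_join minus_join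
  andbC.
Qed.

Lemma only_underlinedE x : only_underlined (join x) = (x.1 == mset0).
Proof. by rewrite /only_underlined all_underlinedE plus_join. Qed.

Lemma only_nonunderlinedE x : only_nonunderlined (join x) = (x.2 == mset0).
Proof.
by rewrite /only_nonunderlined has_underlinedE minus_join negbK.
Qed.

Lemma join_eq0 x : (join x == mset0) = (x == (mset0, mset0)).
Proof. by rewrite -join0 (can_eq joinK). Qed.

Lemma odd_count_join x :
  odd (count (barred \o letter_of) (join x)) = eps x.1 (+) eps x.2.
Proof.
by rewrite (permP (perm_eq_seq_mset _)) count_cat !count_map oddD.
Qed.

Lemma no_repeatP (K : choiceType) (P : pred K) (B : {mset K}) :
  reflect (forall x, P x -> B x <= 1) (no_repeat P B).
Proof.
apply: (iffP allP) => h x; last by move=> _; apply/implyP; apply: h.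
move=> Px; case: (boolP (x \in B)) => [/h/implyP/(_ Px)//|].
by rewrite -mset_eq0 => /eqP->.
Qed.

Lemma no_repeat_join x : no_repeat (barred \o letter_of) (join x)
  = no_repeat barred x.1 && no_repeat barred x.2.
Proof.
apply/no_repeatP/andP => [h|[/no_repeatP h1 /no_repeatP h2] [u l]].
  split; apply/no_repeatP => l bl.
    by have := h (false, l) bl; rewrite joinE.
  by have := h (true, l) bl; rewrite joinE.
by rewrite joinE /= => bl; case: u; [apply: h2|apply: h1].
Qed.

Lemma plus_msum s : plus_part (msum _ s) = msum _ [seq plus_part B | B <- s].
Proof.
apply/msetP => l; rewrite plus_partE !msumE big_map.
by apply: eq_bigr => B _; rewrite plus_partE.
Qed.

Lemma minus_msum s :
  minus_part (msum _ s) = msum _ [seq minus_part B | B <- s].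
Proof.
apply/msetP => l; rewrite minus_partE !msumE big_map.
by apply: eq_bigr => B _; rewrite minus_partE.
Qed.

Lemma symbolsE k m (a : k.-tuple nat) (b : m.-tuple nat) :
  symbols a b = join (letters a b, letters a b).
Proof.
apply/msetP => -[u l]; rewrite joinE /symbols msetE2 !mset_seqE !count_map.
by rewrite !count_pair; case: u; rewrite mul1n mul0n ?addn0.
Qed.

Lemma msum_join (s : seq (block * block)) k m (a : k.-tuple nat)
    (b : m.-tuple nat) :
  (msum _ [seq join x | x <- s] == symbols a b) =
  (msum _ [seq x.1 | x <- s] == letters a b) &&
  (msum _ [seq x.2 | x <- s] == letters a b).
Proof.
rewrite symbolsE -(can_eq partsK) joinK xpair_eqE /parts /=.
rewrite plus_msum minus_msum -!map_comp.
have -> : [seq (plus_part \o join) x | x <- s] = [seq x.1 | x <- s].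
  by apply: eq_map => x; rewrite /= plus_join.
have -> // : [seq (minus_part \o join) x | x <- s] = [seq x.2 | x <- s].
by apply: eq_map => x; rewrite /= minus_join.
Qed.

(** * The order on biwords *)

Definition bottom_lt (x y : block) : bool :=
  [|| eps x && ~~ eps y, [&& ~~ eps x, ~~ eps y & llt x y] |
      [&& eps x, eps y & llt y x]].

Lemma pair_ltE x y :
  pair_lt x y = llt x.1 y.1 || (x.1 == y.1) && bottom_lt x.2 y.2.
Proof. by []. Qed.

Lemma bottom_lt_irr x : bottom_lt x x = false.
Proof. by rewrite /bottom_lt llt_irr; case: (eps x). Qed.

Lemma bottom_lt_trans y x z : bottom_lt x y -> bottom_lt y z -> bottom_lt x z.
Proof.
rewrite /bottom_lt; case: (eps x); case: (eps y); case: (eps z);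
  rewrite /= ?orbF //; first by move=> h1 h2; exact: llt_trans h2 h1.
exact: llt_trans.
Qed.

Lemma bottom_lt_total x y : [|| x == y, bottom_lt x y | bottom_lt y x].
Proof.
have := lle_total x y; rewrite /lle /bottom_lt (eq_sym y).
by case: (x == y) => //=; case: (eps x); case: (eps y);
  rewrite //= ?orbF // orbC.
Qed.

Lemma pair_lt_irr x : pair_lt x x = false.
Proof. by rewrite pair_ltE llt_irr bottom_lt_irr andbF. Qed.

Lemma pair_lt_trans : transitive pair_lt.
Proof.
move=> y x z; rewrite !pair_ltE.
case/orP=> [h1|/andP[/eqP e1 h1]] /orP[h2|/andP[/eqP e2 h2]].
- by rewrite (llt_trans _ _ _ h1 h2).
- by rewrite -e2 h1.
- by rewrite e1 h2.
- by rewrite e1 e2 eqxx (bottom_lt_trans _ _ _ h1 h2) orbT.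
Qed.

Lemma pair_le_trans : transitive pair_le.
Proof.
move=> y x z /orP[/eqP->//|h1] /orP[/eqP<-|h2]; rewrite /pair_le ?h1 ?orbT //.
by rewrite (pair_lt_trans _ _ _ h1 h2) orbT.
Qed.

Lemma pair_le_anti : antisymmetric pair_le.
Proof.
move=> x y /andP[/orP[/eqP//|h1] /orP[/eqP->//|h2]].
by have := pair_lt_trans _ _ _ h1 h2; rewrite pair_lt_irr.
Qed.

Lemma pair_le_total : total pair_le.
Proof.
move=> [x1 x2] [y1 y2]; rewrite /pair_le !pair_ltE !xpair_eqE /=.
have := lle_total x1 y1; have := bottom_lt_total x2 y2; rewrite /lle.
rewrite (eq_sym y1) (eq_sym y2).
have [->|_] := eqVneq x1 y1; rewrite /= ?llt_irr //=.
  by case: (x2 == y2) => //=.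
by rewrite !orbF.
Qed.

Lemma pair_ltw_trans : transitive pair_ltw.
Proof.
move=> y x z /orP[h1|/andP[/eqP-> _] //] /orP[h2|/andP[/eqP<- _]].
  by rewrite /pair_ltw (pair_lt_trans _ _ _ h1 h2).
by rewrite /pair_ltw h1.
Qed.

Lemma count_gt1_pairwise (A : eqType) (r : rel A) x s :
  pairwise r s -> 1 < count_mem x s -> r x x.
Proof.
elim: s => [//|y s IH] /= /andP[/allP ry /IH{}IH].
have [<-|_] := eqVneq y x; last exact: IH.
by rewrite addSn ltnS -has_count has_pred1 => /ry.
Qed.

(** The strict order on biwords encodes the rule that a pair of odd total parity
    occurs at most once. *)
Lemma sorted_pair_ltw w : sorted pair_ltw w <->
  sorted pair_le w /\
  (forall x, eps x.1 (+) eps x.2 -> count_mem x w <= 1).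
Proof.
split=> [sw|[sw cw]].
  split.
    apply: sub_sorted sw => x y; rewrite /pair_ltw /pair_le.
    by case/orP=> [->|/andP[-> _]]; rewrite ?orbT.
  move=> x ox; rewrite leqNgt; apply/negP.
  move: sw; rewrite (sorted_pairwise pair_ltw_trans) => pw.
  by move/(count_gt1_pairwise _ _ _ _ pw); rewrite /pair_ltw pair_lt_irr eqxx ox.
elim: w sw cw => [//|x [//|y w] IH] /= /andP[xy sw] cw.
apply/andP; split; last first.
  by apply: IH => // z /cw; apply: leq_trans; rewrite leq_addl.
case/orP: xy => [/eqP e|h]; last by rewrite /pair_ltw h.
rewrite /pair_ltw e eqxx; case: (boolP (_ (+) _)) => h; rewrite ?orbT //.
by have := cw _ h; rewrite e eqxx.
Qed.

(** * Partitions as biwords with two lists of blocks *)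

Definition und (p : {mset {mset symbol}}) : seq block :=
  [seq minus_part B | B <- p & only_underlined B].
Definition non (p : {mset {mset symbol}}) : seq block :=
  [seq plus_part B | B <- p & only_nonunderlined B].

Definition pairs (w : seq (block * block)) (U V : seq block) :=
  w ++ [seq (mset0, u) | u <- U] ++ [seq (v, mset0) | v <- V].

Lemma perm_biword p :
  perm_eq (biword p) [seq parts B | B <- p & propagating B].
Proof. by rewrite perm_sort. Qed.

(** A nonempty block has exactly one of the three types. *)
Lemma count_three (q : pred {mset symbol}) (s : seq {mset symbol}) :
    all (fun B => B != mset0) s ->
  count q s = count (predI q propagating) s +
    (count (predI q only_underlined) s + count (predI q only_nonunderlined) s).
Proof.
elim: s => [//|B s IH] /= /andP[B0 /IH->].
have : ~~ (only_underlined B && only_nonunderlined B).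
  rewrite /only_underlined /only_nonunderlined all_underlinedE has_underlinedE.
  rewrite negbK; apply: contra B0 => /andP[].
  move=> /eqP e1 /eqP e2; rewrite -(partsK B) /parts e1 e2.
  by rewrite join_eq0.
rewrite /propagating /only_underlined /only_nonunderlined.
by case: (all _ B); case: (has _ B); case: (q B) => //= _; lia.
Qed.


Lemma partition_pairs (p : {mset {mset symbol}}) : mset0 \notin p ->
  p = seq_mset [seq join x | x <- pairs (biword p) (und p) (non p)].
Proof.
move=> p0; rewrite -[LHS]seq_mset_id; apply/eq_seq_msetP.
have pe : perm_eq [seq join x | x <- pairs (biword p) (und p) (non p)]
   ([seq B <- p | propagating B] ++ [seq B <- p | only_underlined B] ++
    [seq B <- p | only_nonunderlined B]).
  rewrite /pairs !map_cat; apply: perm_cat; last apply: perm_cat.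
  - apply: perm_trans (perm_map _ (perm_biword p)) _.
    by rewrite -map_comp (eq_map partsK) map_id.
  - rewrite -!map_comp; set s := [seq _ <- _ | _].
    suff -> : [seq (join \o pair mset0 \o minus_part) B | B <- s] = s by [].
    rewrite -[RHS]map_id; apply/eq_in_map => B; rewrite mem_filter.
    rewrite /only_underlined all_underlinedE => /andP[/eqP e _].
    by rewrite /= -e; apply: partsK.
  - rewrite -!map_comp; set s := [seq _ <- _ | _].
    suff -> : [seq (join \o (fun v => (v, mset0)) \o plus_part) B | B <- s] = s.
      by [].
    rewrite -[RHS]map_id; apply/eq_in_map => B; rewrite mem_filter.
    rewrite /only_nonunderlined has_underlinedE negbK => /andP[/eqP e _].
    by rewrite /= -e; apply: partsK.
rewrite (permPr pe) {pe}; apply/permP => q; rewrite !count_cat !count_filter.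
have {p0} : all (fun B => B != mset0) p.
  by apply/allP => B Bp; apply: contraNneq p0 => <-.
exact: count_three.
Qed.

Lemma count_map0 (A : eqType) (B : eqType) (f : A -> B) (y : B) s :
  (forall x, x \in s -> f x != y) -> count_mem y [seq f x | x <- s] = 0.
Proof.
move=> h; apply/count_memPn/mapP => -[x xs e].
by move: (h x xs); rewrite e eqxx.
Qed.

(** The two coordinates of a pair tell which of the three lists it came from. *)
Lemma count_pairs w U V x :
    mset0 \notin [seq y.1 | y <- w] ++ V ->
    mset0 \notin [seq y.2 | y <- w] ++ U ->
  x != (mset0, mset0) ->
  count_mem x (pairs w U V) =
    if x.1 == mset0 then count_mem x.2 U
    else if x.2 == mset0 then count_mem x.1 V else count_mem x w.
Proof.
rewrite !mem_cat !negb_or => /andP[w1 V0] /andP[w2 U0] x0.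
rewrite /pairs !count_cat.
have cw : (x.1 == mset0) || (x.2 == mset0) -> count_mem x w = 0.
  move=> h; apply/count_memPn; apply: contraL h => xw; rewrite negb_or.
  apply/andP; split; [apply: contraNneq w1|apply: contraNneq w2] => <-;
    exact: map_f.
case: x cw x0 => [x1 x2] /= cw; rewrite xpair_eqE.
have [e1 ne2|ne1 _] := eqVneq x1 mset0.
  rewrite cw ?e1 ?eqxx // [X in _ + (_ + X)]count_map0 ?addn0; last first.
    by move=> v vV; rewrite xpair_eqE negb_and; apply/orP; left;
      apply: contraNneq V0 => <-.
  rewrite count_map; apply: eq_count => u /=.
  by rewrite xpair_eqE eqxx.
rewrite [X in _ + (X + _)]count_map0; last first.
  by move=> u _; rewrite xpair_eqE eq_sym (negPf ne1).
rewrite add0n; have [e2|ne2] := eqVneq x2 mset0.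
  rewrite cw ?e2 ?eqxx ?orbT // count_map; apply: eq_count => v /=.
  by rewrite xpair_eqE eqxx andbT.
rewrite count_map0 ?addn0 // => v _.
by rewrite xpair_eqE negb_and eq_sym (eq_sym mset0) ne2 orbT.
Qed.

(** The conditions that the restrictions on a partition impose on the list of
    all its underlined parts, and likewise on that of its other parts. *)
Definition admissible k m (a : k.-tuple nat) (b : m.-tuple nat)
    (s : seq block) : Prop :=
  [/\ mset0 \notin s, msum _ s = letters a b & all (no_repeat barred) s].

Lemma admissible_perm k m (a : k.-tuple nat) (b : m.-tuple nat) s s' :
  perm_eq s s' -> admissible k m a b s -> admissible k m a b s'.
Proof.
move=> ps [h1 h2 h3]; split; first by rewrite -(perm_mem ps).
  by rewrite -(msum_perm _ _ _ ps).
by rewrite -(perm_all _ ps).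
Qed.

Definition odd_once (s : seq block) : Prop :=
  forall S, eps S -> count_mem S s <= 1.

Lemma eps0 : eps mset0 = false.
Proof. by rewrite /eps enum_mset0. Qed.

(** Underlined and other symbols form disjoint alphabets, so the conditions on
    sums and on repeated symbols split; multiplicities of blocks are computed in
    the three lists by [count_pairs]. *)
Lemma restricted_pairs k m (a : k.-tuple nat) (b : m.-tuple nat) w U V :
    mset0 \notin [seq y.1 | y <- w] ++ V ->
    mset0 \notin [seq y.2 | y <- w] ++ U ->
  restricted_mpartitions a b (seq_mset [seq join x | x <- pairs w U V]) <->
  [/\ admissible k m a b ([seq y.1 | y <- w] ++ V),
      admissible k m a b ([seq y.2 | y <- w] ++ U),
      odd_once U, odd_once V &
      forall x, eps x.1 (+) eps x.2 -> count_mem x w <= 1].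
Proof.
move=> w10 w20; set p := seq_mset _.
have pp : perm_eq p [seq join x | x <- pairs w U V] by exact: perm_eq_seq_mset.
have p1 : [seq x.1 | x <- pairs w U V]
    = [seq y.1 | y <- w] ++ nseq (size U) mset0 ++ V.
  rewrite /pairs !map_cat -!map_comp; congr (_ ++ (_ ++ _)).
    by elim: (U) => //= u s ->.
  exact: map_id.
have p2 : [seq x.2 | x <- pairs w U V]
    = [seq y.2 | y <- w] ++ U ++ nseq (size V) mset0.
  rewrite /pairs !map_cat -!map_comp; congr (_ ++ (_ ++ _)).
    exact: map_id.
  by elim: (V) => //= u s ->.
have p0 : mset0 \notin p.
  rewrite (perm_mem pp); apply/mapP => -[x xp /eqP].
  rewrite eq_sym join_eq0 => /eqP xE; subst x; move: xp; rewrite /pairs !mem_cat.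
  case/or3P=> [h|/mapP[u uU [e]]|/mapP[v vV [e]]].
  - by case/negP: w10; rewrite mem_cat (map_f (fun y => y.1) h).
  - by case/negP: w20; rewrite mem_cat e uU orbT.
  - by case/negP: w10; rewrite mem_cat e vV orbT.
have msum0 s1 s2 n : msum _ (s1 ++ nseq n mset0 ++ s2) = msum letter (s1 ++ s2).
  apply/msetP => l; rewrite !msumE !big_cat /=; congr (_ + _).
  rewrite big1_seq // => B /andP[_ /nseqP[-> _]]; exact: mset0E.
have sumE : mset_partition (symbols a b) p =
    (msum _ ([seq y.1 | y <- w] ++ V) == letters a b) &&
    (msum _ ([seq y.2 | y <- w] ++ U) == letters a b).
  rewrite /mset_partition p0 /= -/(msum _ p) (msum_perm _ _ _ pp) msum_join.
  rewrite p1 p2 msum0; congr (_ && (_ == _)).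
  have := msum0 ([seq y.2 | y <- w] ++ U) [::] (size V).
  by rewrite !cats0 -catA => ->.
have nr0 n : all (no_repeat barred) (nseq n mset0).
  by rewrite all_nseq /no_repeat enum_mset0 orbT.
have nrE : all (no_repeat (barred \o letter_of)) p =
    all (no_repeat barred) ([seq y.1 | y <- w] ++ V) &&
    all (no_repeat barred) ([seq y.2 | y <- w] ++ U).
  rewrite (perm_all _ pp) all_map (eq_all no_repeat_join) all_predI.
  by rewrite -!(all_map (fun x => _ x)) p1 p2 !all_cat !nr0 /= andbT.
have cE x : p (join x) = count_mem x (pairs w U V).
  rewrite mset_seqE count_map; apply: eq_count => y /=.
  exact: (can_eq joinK).
rewrite /restricted_mpartitions /= sumE nrE; split.
  case=> /andP[/eqP s1 /eqP s2] /andP[n1 n2] hB; split=> //.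
  - move=> S oS; rewrite leqNgt; apply/negP => h.
    have S0 : S != mset0 by apply: contraTneq oS => ->; rewrite eps0.
    have := hB (join (mset0, S)); rewrite cE count_pairs //= ?eqxx.
      by move/(_ h); rewrite odd_count_join /= eps0 oS.
    by rewrite xpair_eqE eqxx.
  - move=> S oS; rewrite leqNgt; apply/negP => h.
    have S0 : S != mset0 by apply: contraTneq oS => ->; rewrite eps0.
    have := hB (join (S, mset0)); rewrite cE count_pairs //= ?eqxx ?(negPf S0).
      by move/(_ h); rewrite odd_count_join /= eps0 oS.
    by rewrite xpair_eqE (negPf S0).
  - move=> x ox; rewrite leqNgt; apply/negP => h.
    have := hB (join x); rewrite cE odd_count_join ox => /(_ _)/negP; apply=> //.
    apply: leq_trans h _; rewrite /pairs count_cat; exact: leq_addr.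
case=> -[_ -> n1] [_ -> n2] oU oV ow; rewrite !eqxx n1 n2; split=> // B.
rewrite -(partsK B) cE odd_count_join; set x := parts B.
have [->|x0] := eqVneq x (mset0, mset0); first by rewrite /= eps0.
rewrite count_pairs // => h; apply: contraTN h; rewrite -leqNgt.
case: ifP => [/eqP->|_]; first by rewrite eps0 => /oU.
case: ifP => [/eqP->|_]; last exact: ow.
by rewrite eps0 addbF => /oV.
Qed.

Lemma biword_nonempty (p : {mset {mset symbol}}) : mset0 \notin p ->
  mset0 \notin [seq y.1 | y <- biword p] ++ non p /\
  mset0 \notin [seq y.2 | y <- biword p] ++ und p.
Proof.
move=> p0; have pB (B : {mset symbol}) : B \in p ->
    ~~ ((plus_part B == mset0) && (minus_part B == mset0)).
  move=> Bp; apply: contra p0 => /andP[/eqP e1 /eqP e2].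
  have <- // : B = mset0.
  by rewrite -(partsK B) /parts e1 e2 join0.
have pw y : y \in biword p -> (y.1 != mset0) && (y.2 != mset0).
  rewrite (perm_mem (perm_biword p)) => /mapP[B].
  rewrite mem_filter /propagating has_underlinedE all_underlinedE.
  by case/andP=> /andP[h1 h2] _ ->; rewrite /= h1 h2.
split; rewrite mem_cat negb_or; apply/andP; split; apply/mapP => -[].
- by move=> y /pw/andP[/eqP h1 _] /esym.
- move=> B; rewrite mem_filter /only_nonunderlined has_underlinedE negbK.
  by case/andP=> h1 /pB; rewrite h1 andbT eq_sym => h /eqP; rewrite (negPf h).
- by move=> y /pw/andP[_ /eqP h1] /esym.
- move=> B; rewrite mem_filter /only_underlined all_underlinedE.
  by case/andP=> h1 /pB; rewrite h1 /= eq_sym => h /eqP; rewrite (negPf h).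
Qed.

Lemma pairs_parts w U V (p := seq_mset [seq join x | x <- pairs w U V]) :
    mset0 \notin [seq y.1 | y <- w] ++ V ->
    mset0 \notin [seq y.2 | y <- w] ++ U ->
  [/\ perm_eq (biword p) w, perm_eq (und p) U & perm_eq (non p) V].
Proof.
rewrite !mem_cat !negb_or => /andP[w1 V0] /andP[w2 U0].
have pp : perm_eq p [seq join x | x <- pairs w U V] by exact: perm_eq_seq_mset.
have mw y : y \in w -> (y.1 == mset0 = false) * (y.2 == mset0 = false).
  move=> yw; split; apply/negP => /eqP e.
    by case/negP: w1; rewrite -e map_f.
  by case/negP: w2; rewrite -e map_f.
have mU u : u \in U -> (u == mset0) = false.
  by move=> uU; apply/negP => /eqP e; case/negP: U0; rewrite -e.
have mV v : v \in V -> (v == mset0) = false.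
  by move=> vV; apply/negP => /eqP e; case/negP: V0; rewrite -e.
have F (A : eqType) (q : pred {mset symbol}) (f : {mset symbol} -> A) s :
    [seq f (join x) | x <- pairs w U V & q (join x)] = s ->
    perm_eq [seq f B | B <- p & q B] s.
  move=> <-; apply: perm_trans (perm_map f (perm_filter q pp)) _.
  by rewrite filter_map -map_comp.
have fw (q : pred (block * block)) c : (forall y, y \in w -> q y = c) ->
    [seq y <- w | q y] = if c then w else [::].
  move=> h; rewrite (eq_in_filter (a2 := fun _ => c)) //.
  by case: c {h}; rewrite ?filter_predT ?filter_pred0.
have fU (q : pred (block * block)) c :
    (forall u, u \in U -> q (mset0, u) = c) ->
    [seq y <- [seq (mset0, u) | u <- U] | q y]
    = if c then [seq (mset0, u) | u <- U] else [::].
  move=> h; rewrite (eq_in_filter (a2 := fun _ => c)).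
    by case: c {h}; rewrite ?filter_predT ?filter_pred0.
  by move=> y /mapP[u uU ->]; exact: h.
have fV (q : pred (block * block)) c :
    (forall v, v \in V -> q (v, mset0) = c) ->
    [seq y <- [seq (v, mset0) | v <- V] | q y]
    = if c then [seq (v, mset0) | v <- V] else [::].
  move=> h; rewrite (eq_in_filter (a2 := fun _ => c)).
    by case: c {h}; rewrite ?filter_predT ?filter_pred0.
  by move=> y /mapP[v vV ->]; exact: h.
split.
- apply: perm_trans (perm_biword p) _; apply: F.
  rewrite /pairs !filter_cat (fw _ true) ?(fU _ false) ?(fV _ false) ?cats0.
  + by rewrite (eq_map joinK) map_id.
  + by move=> v _; rewrite propagatingE eqxx andbF.
  + by move=> u _; rewrite propagatingE eqxx.
  + by move=> y /mw[h1 h2]; rewrite propagatingE h1 h2.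
- apply: F; rewrite /pairs !filter_cat (fw _ false) ?(fU _ true)
    ?(fV _ false) ?cats0.
  + rewrite -map_comp -[RHS]map_id; apply: eq_map => u.
    by rewrite /= minus_join.
  + by move=> v /mV h; rewrite only_underlinedE h.
  + by move=> u _; rewrite only_underlinedE eqxx.
  + by move=> y /mw[h1 h2]; rewrite only_underlinedE h1.
- apply: F; rewrite /pairs !filter_cat (fw _ false) ?(fU _ false)
    ?(fV _ true) ?cats0.
  + rewrite -map_comp -[RHS]map_id; apply: eq_map => u.
    by rewrite /= plus_join.
  + by move=> v _; rewrite only_nonunderlinedE eqxx.
  + by move=> u /mU h; rewrite only_nonunderlinedE h.
  + by move=> y /mw[h1 h2]; rewrite only_nonunderlinedE h2.
Qed.

(** * The first row *)

(** A tableau given by its part [T] above the first row and by the nonempty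
    blocks [s] of the first row. *)
Definition upper_part k m (a : k.-tuple nat) (b : m.-tuple nat)
    (T : tableau) (s : seq block) : Prop :=
  [/\ young T, semistandard T, admissible k m a b (flatten T ++ s) &
      odd_once s].

Definition first_row n T (s : seq block) : seq block :=
  nseq (n - nboxes T - size s) mset0 ++ sort lle s.

Lemma nboxes_flatten T : nboxes T = size (flatten T).
Proof. by rewrite /nboxes /Defs.shape -size_flatten. Qed.

Lemma upper_size k m (a : k.-tuple nat) (b : m.-tuple nat) T s :
  upper_part k m a b T s -> nboxes T + size s <= sumn a + sumn b.
Proof.
case=> _ _ [h0 h1 _] _; rewrite nboxes_flatten -size_cat.
by rewrite -(size_letters _ _ a b) -h1; apply: size_le_msum.
Qed.

Lemma young_nil T : young T -> nboxes T = 0 -> T = [::].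
Proof.
case: T => [//|R T] /andP[_]; rewrite /nboxes /Defs.shape /= inE negb_or.
by case: R.
Qed.

Lemma size_first_row n T s : nboxes T + size s <= n ->
  size (first_row n T s) = n - nboxes T.
Proof. by rewrite size_cat size_nseq size_sort; lia. Qed.

(** With at most [n / 2] boxes to place, the first row is absent only for the
    empty diagram. *)
Lemma add_first_rowE n T s : young T -> 2 * (nboxes T + size s) <= n ->
  add_first_row n T s = if n == 0 then [::] else first_row n T s :: T.
Proof.
move=> yT h; rewrite /add_first_row /= -/(first_row n T s).
have sz := size_first_row n T s; case: nilP => e.
  have n0 : n = 0.
    by move: sz; rewrite e /=; lia.
  by rewrite n0 eqxx (young_nil T) //; lia.
suff -> : (n == 0) = false by [].
apply/negP => /eqP n0; case: e; apply/size0nil; rewrite sz; lia.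
Qed.

Lemma first_row_count n T s S : S != mset0 ->
  count_mem S (first_row n T s) = count_mem S s.
Proof.
move=> S0; rewrite count_cat count_nseq /= eq_sym (negPf S0) mul0n add0n.
by apply/permP; rewrite perm_sort.
Qed.

Lemma first_row_sorted n T s : sorted lle (first_row n T s).
Proof.
rewrite /first_row; elim: (n - _ - _) => [|j IH] /=.
  exact: (sort_sorted lle_total).
by rewrite path_min_sorted //; apply/allP => S _; exact: lle0.
Qed.

Lemma first_row_filter n T s : mset0 \notin s ->
  [seq S <- first_row n T s | S != mset0] = sort lle s.
Proof.
move=> s0; rewrite filter_cat filter_nseq eqxx /=; apply/all_filterP/allP => S.
by rewrite mem_sort => Ss; apply: contraNneq s0 => <-.
Qed.

Lemma column_cons R T c :
  column (R :: T) c = (if c < size R then [:: nth mset0 R c] else [::])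
    ++ column T c.
Proof. by rewrite /column /=; case: ifP. Qed.

Lemma column_nil T c : young T -> size (row T 0) <= c -> column T c = [::].
Proof.
move=> yT h; apply: size0nil; rewrite (size_column _ _ _ (ideal_cells _ yT)).
  by apply/eqP; rewrite -leqn0 leqNgt -(ideal_cells _ yT) rlen_cells -leqNgt.
exact: has_shape_young.
Qed.

Lemma row0_le T : size (row T 0) <= nboxes T.
Proof. by case: T => [//|R T]; rewrite /nboxes /= leq_addr. Qed.

(** As [n] is at least twice the number of blocks, the first row has at least as
    many empty boxes as there are blocks, and in particular as there are boxes in
    the second row. *)
Lemma add_first_row_SSMT n k m (a : k.-tuple nat) (b : m.-tuple nat) T s :
    upper_part k m a b T s -> 2 * (nboxes T + size s) <= n ->
  is_partition n (Defs.shape (add_first_row n T s)) /\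
  SSMT (Defs.shape (add_first_row n T s)) a b (add_first_row n T s).
Proof.
case=> yT ssT [h0 h1 h2] os hn; rewrite add_first_rowE //.
have [n0|n0] := eqVneq n 0.
  have T0 : T = [::] by apply: young_nil => //; lia.
  have s0 : s = [::] by apply: size0nil; lia.
  subst n T s; split=> //; split=> //.
  - by split=> // r _; rewrite /row nth_nil.
  - rewrite /mset_partition /content /= -/(msum _ _).
    have -> : seq_mset [::] = mset0 :> {mset block}.
      by apply/msetP => B; rewrite mset_seqE mset0E.
    by rewrite in_mset0 -h1 /= /msum enum_mset0 !big_nil.
  - rewrite /content /=; apply/allP => B.
    by rewrite (perm_mem (perm_eq_seq_mset _)).
set R := first_row n T s.
have sR : size R = n - nboxes T by rewrite size_first_row //; lia.
pose j := n - nboxes T - size s.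
have jT : size (row T 0) <= j by have := row0_le T; rewrite /j; lia.
have j0 : 0 < j by rewrite /j; lia.
have jR : j <= size R by rewrite sR /j; lia.
have Rj c : c < j -> nth mset0 R c = mset0.
  by move=> cj; rewrite nth_cat size_nseq -/j cj nth_nseq cj.
have s0 : mset0 \notin s by move: h0; rewrite mem_cat negb_or => /andP[].
have fT0 : mset0 \notin flatten T.
  by move: h0; rewrite mem_cat negb_or => /andP[].
have pc : perm_eq (content (R :: T)) (flatten T ++ s).
  apply: perm_trans (perm_eq_seq_mset _) _; rewrite /= filter_cat.
  rewrite first_row_filter // perm_catC; apply: perm_cat; rewrite ?perm_sort //.
  suff -> : [seq S <- flatten T | S != mset0] = flatten T by [].
  by apply/all_filterP/allP => S Ss; apply: contraNneq fT0 => <-.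
split.
  apply/and3P; split.
  - rewrite /= path_min_sorted; first by case/andP: yT.
    apply/allP => x /(nthP 0)[i]; rewrite size_map => ilt <-.
    rewrite nth_shape /= sR.
    apply: leq_trans (young_noninc _ _ _ yT (leq0n i)) _.
    by apply: leq_trans jT _; rewrite /j; lia.
  - rewrite /= inE negb_or; case/andP: yT => _ ->; rewrite andbT eq_sym -lt0n.
    exact: leq_trans j0 jR.
  - by rewrite /= -/(nboxes T) sR; apply/eqP; lia.
split.
- split=> //.
  + move=> [//|r] _; rewrite /row /= -/(row T r).
    apply: contra fT0 => Sr; apply/flattenP; exists (row T r) => //.
    apply: mem_nth; rewrite ltnNge; apply: contraTN Sr => /row_default->.
    by rewrite in_nil.
  + by move=> _; rewrite /row /= -(Rj 0 j0) mem_nth // (leq_trans j0).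
  + move=> c; rewrite /= nth_shape => cT; apply: Rj; exact: leq_trans cT jT.
- rewrite /mset_partition -/(msum _ _) (msum_perm _ _ _ pc) h1 eqxx andbT.
  by rewrite (perm_mem pc).
- by rewrite (perm_all _ pc).
- have [sr sc ce co] := ssT; split.
  + by move=> [|r]; [exact: first_row_sorted|exact: sr].
  + move=> c; rewrite column_cons; case: ifP => [cR /=|_]; last exact: sc.
    case: (ltnP c (size (row T 0))) => cT; last by rewrite column_nil.
    rewrite path_min_sorted ?sc // Rj; last exact: leq_trans jT.
    by apply/allP => S _; exact: lle0.
  + move=> c S S0 eS; rewrite column_cons count_cat.
    case: (ltnP c (size (row T 0))) => cT.
      rewrite Rj; last exact: leq_trans jT.
      by case: ifP => _ /=; rewrite ?(eq_sym mset0) ?(negPf S0); apply: ce.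
    rewrite column_nil // addn0; case: ifP => _ //=.
    by rewrite addn0; case: (_ == _).
  + move=> [|r] S S0 eS; last exact: co.
    by rewrite /row /= first_row_count //; apply: os.
Qed.

Lemma sorted_first_row (R : seq block) : sorted lle R ->
  R = nseq (size R - size [seq S <- R | S != mset0]) mset0
      ++ [seq S <- R | S != mset0].
Proof.
elim: R => [//|S R IH] /= sR; have {IH} IHR := IH (path_sorted sR).
have [e|S0] := eqVneq S mset0.
  rewrite /= subSn /=; first by rewrite e -IHR.
  by rewrite size_filter count_size.
suff -> : [seq S' <- R | S' != mset0] = R by rewrite subnn.
apply/all_filterP/allP => S' S'R; apply: contraNneq S0 => e.
have := order_path_min lle_trans sR; move/allP/(_ _ S'R); rewrite e.
by case/orP=> [//|]; rewrite lltm0.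
Qed.

(** The empty multiset is the least one, so in an increasing first row the empty
    boxes come first and the row is determined by its length and its blocks. *)
Lemma SSMT_first_row n k m (a : k.-tuple nat) (b : m.-tuple nat) l T' :
    is_partition n l -> SSMT l a b T' ->
  exists T s, [/\ upper_part k m a b T s, T' = add_first_row n T s,
    Defs.shape T = behead l & sorted lle s].
Proof.
case/and3P=> sl l0 /eqP ln [[shT rT r0 _] /andP[c0 /eqP cL] nr ss].
case: T' shT rT r0 c0 cL nr ss => [|R T] shT rT r0 c0 cL nr ss.
  subst l; have n0 : n = 0 by rewrite -ln.
  exists [::], [::]; split=> //; last by rewrite n0.
  split=> //; split=> //; move: cL; rewrite /content /=.
  have -> : seq_mset [::] = mset0 :> {mset block}.
    by apply/msetP => B; rewrite mset_seqE mset0E.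
  by rewrite enum_mset0 big_nil => <-; rewrite /msum big_nil.
pose s := [seq S <- R | S != mset0].
have [sr sc ce co] := ss.
have sR : sorted lle R := sr 0.
have ss' : sorted lle s by apply: sorted_filter => //; exact: lle_trans.
have fT0 : mset0 \notin flatten T.
  apply/flattenP => -[R' /(nthP [::])[r rlt <-]].
  by apply/negP; exact: (rT r.+1).
have pc : perm_eq (content (R :: T)) (flatten T ++ s).
  apply: perm_trans (perm_eq_seq_mset _) _; rewrite /= filter_cat -/s perm_catC.
  apply: perm_cat => //.
  suff -> : [seq S <- flatten T | S != mset0] = flatten T by [].
  by apply/all_filterP/allP => S Ss; apply: contraNneq fT0 => <-.
have nE : n = size R + nboxes T by rewrite -ln -shT.
have yT : young T.
  rewrite -shT /= in sl l0; apply/andP; split; first exact: path_sorted sl.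
  by move: l0; rewrite inE negb_or => /andP[].
have colE c : column (R :: T) c = [:: nth mset0 R c] ++ column T c \/
    column T c = [::].
  rewrite column_cons; case: ltnP => cR; [by left|right].
  apply: column_nil => //; apply: leq_trans cR.
  move: sl; rewrite -shT /=; case: (T) => [//|R' T''] /=.
  by case/andP.
have R0 : R <> [::] by move=> e; move: (r0 isT); rewrite e.
exists T, s; split=> //; last by rewrite -shT.
- split=> //.
  + split.
    * by move=> r; exact: (sr r.+1).
    * by move=> c; case: (colE c) (sc c) => [->|-> //] /= /path_sorted.
    * move=> c S S0 eS; case: (colE c) (ce c S S0 eS) => [->|-> //].
      by rewrite count_cat; apply: leq_trans; rewrite leq_addl.
    * by move=> r; exact: (co r.+1).
  + split.
    * by rewrite -(perm_mem pc).
    * by rewrite -(msum_perm _ _ _ pc).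
    * by rewrite -(perm_all _ pc).
  + move=> S eS; have S0 : S != mset0.
      by apply: contraTneq eS => ->; rewrite eps0.
    apply: leq_trans (co 0 S S0 eS); rewrite /s -size_filter -filter_predI.
    rewrite -size_filter size_filter size_filter; apply: sub_count => S'.
    by case/andP.
- rewrite /add_first_row /= (sorted_sort lle_trans) //.
  have -> : n - nboxes T - size s = size R - size s by rewrite nE addnK.
  rewrite -sorted_first_row //.
  by case: nilP => // e; case: R0.
Qed.

Lemma add_first_row_inj n T s T2 s2 : young T -> young T2 ->
    mset0 \notin s -> mset0 \notin s2 ->
    2 * (nboxes T + size s) <= n -> 2 * (nboxes T2 + size s2) <= n ->
  add_first_row n T s = add_first_row n T2 s2 -> T = T2 /\ perm_eq s s2.
Proof.
move=> yT yT2 s0 s20 hn hn2; rewrite !add_first_rowE //.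
have [n0 _|n0 [e ->]] := eqVneq n 0.
  have z x y : 2 * (x + y) <= n -> x = 0 /\ y = 0 by rewrite n0; clear; lia.
  have [/(young_nil _ yT)-> /size0nil->] := z _ _ hn.
  by have [/(young_nil _ yT2)-> /size0nil->] := z _ _ hn2.
split=> //; have := congr1 (filter (fun S => S != mset0)) e.
rewrite !first_row_filter // => e2.
by rewrite -(perm_sort lle) e2 perm_sort.
Qed.

(** * The bijection *)

Lemma reps_shape T U P Q : reps T P -> reps U Q ->
  perm_eq (boxes P) (boxes Q) -> Defs.shape T = Defs.shape U.
Proof.
move=> [[s1 s2] _] [[u1 u2] _] pPQ.
apply: (@eq_from_nth _ 0); first by rewrite !size_map s1 u1 (clen_perm _ _ pPQ).
by move=> i _; rewrite !nth_shape s2 u2 (rlen_perm _ _ pPQ).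
Qed.

Lemma shape_reps T U P Q : reps T P -> reps U Q ->
    chain [::] (boxes P) -> chain [::] (boxes Q) ->
  Defs.shape T = Defs.shape U -> perm_eq (boxes P) (boxes Q).
Proof.
move=> [[_ s2] _] [[_ u2] _] cP cQ sh.
apply: uniq_perm; [exact: chain_uniq|exact: chain_uniq|].
by move=> [r c]; rewrite !chain_mem // -s2 -u2 -!nth_shape sh.
Qed.

Lemma smRSKE n p : smRSK n p =
  (add_first_row n (sRSK (biword p)).1 (und p),
   add_first_row n (sRSK (biword p)).2 (non p)).
Proof. by rewrite /smRSK; case: (sRSK _). Qed.

Lemma add_first_row_perm n T s s' : perm_eq s s' ->
  add_first_row n T s = add_first_row n T s'.
Proof.
move=> ps; rewrite /add_first_row (perm_size ps).
by have/perm_sortP-> := ps; [|exact: lle_total|exact: lle_trans|exact: lle_anti].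
Qed.

Lemma smRSK_parts k m (a : k.-tuple nat) (b : m.-tuple nat) p :
    restricted_mpartitions a b p ->
  let w := biword p in
  [/\ mset0 \notin p, sorted pair_ltw w,
      Defs.shape (sRSK w).1 = Defs.shape (sRSK w).2,
      upper_part k m a b (sRSK w).1 (und p) &
      upper_part k m a b (sRSK w).2 (non p)].
Proof.
move=> rp w; have p0 : mset0 \notin p by case: rp => /andP[].
have [w1 w2] := biword_nonempty p p0.
move: (rp); rewrite {1}(partition_pairs p p0).
case/(restricted_pairs _ _ _ _ _ _ _ w1 w2) => aV aU oU oV ow.
have sw : sorted pair_ltw w.
  by apply/sorted_pair_ltw; split=> //; apply: (sort_sorted pair_le_total).
have [P [Q [r rP rQ]]] := sRSK_rsk w.
have [[cP cQ sP pPQ] [vP vQ]] := rsk_shape _ _ _ r.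
have sQ : sorted lt_entry Q by rewrite -(rsk_sorted _ _ _ r).
split=> //; first exact: (reps_shape _ _ _ _ rP rQ).
- split=> //; first exact: (entries_young _ _ cP rP).
    exact: (entries_semistandard _ _ cP sP rP).
  apply: admissible_perm aU; rewrite perm_cat2r perm_sym.
  by apply: perm_trans (reps_flatten _ _ cP rP) vP.
- split=> //; first exact: (entries_young _ _ cQ rQ).
    exact: (entries_semistandard _ _ cQ sQ rQ).
  apply: admissible_perm aV; rewrite perm_cat2r perm_sym -vQ.
  exact: (reps_flatten _ _ cQ rQ).
Qed.

Lemma smRSK_inj k m (a : k.-tuple nat) (b : m.-tuple nat) n p p' :
    2 * (sumn a + sumn b) <= n ->
    restricted_mpartitions a b p -> restricted_mpartitions a b p' ->
  smRSK n p = smRSK n p' -> p = p'.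
Proof.
move=> hn rp rp'; rewrite !smRSKE => -[e1 e2].
have [p0 sw _ uT uU] := smRSK_parts _ _ _ _ _ rp.
have [p0' sw' _ uT' uU'] := smRSK_parts _ _ _ _ _ rp'.
have bound T s : upper_part k m a b T s -> 2 * (nboxes T + size s) <= n.
  by move/upper_size => h; apply: leq_trans hn; rewrite leq_pmul2l.
have nonempty T s : upper_part k m a b T s -> mset0 \notin s.
  by case=> _ _ [+ _ _] _; rewrite mem_cat negb_or => /andP[].
have yg T s : upper_part k m a b T s -> young T by case.
have [Te pU] := add_first_row_inj _ _ _ _ _ (yg _ _ uT) (yg _ _ uT')
  (nonempty _ _ uT) (nonempty _ _ uT') (bound _ _ uT) (bound _ _ uT') e1.
have [Ue pV] := add_first_row_inj _ _ _ _ _ (yg _ _ uU) (yg _ _ uU')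
  (nonempty _ _ uU) (nonempty _ _ uU') (bound _ _ uU) (bound _ _ uU') e2.
have [P [Q [r rP rQ]]] := sRSK_rsk (biword p).
have [P' [Q' [r' rP' rQ']]] := sRSK_rsk (biword p').
have [[cP cQ sP _] _] := rsk_shape _ _ _ r.
have [[cP' cQ' sP' _] _] := rsk_shape _ _ _ r'.
have sQ : sorted lt_entry Q by rewrite -(rsk_sorted _ _ _ r).
have sQ' : sorted lt_entry Q' by rewrite -(rsk_sorted _ _ _ r').
rewrite -Te in rP'; rewrite -Ue in rQ'.
have PE := entries_unique _ _ _ cP sP rP cP' sP' rP'.
have QE := entries_unique _ _ _ cQ sQ rQ cQ' sQ' rQ'.
have wE : biword p = biword p' by apply: (rsk_inj _ _ P Q); rewrite // PE QE.
rewrite (partition_pairs _ p0) (partition_pairs _ p0') wE.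
apply/eq_seq_msetP/perm_map; rewrite /pairs perm_cat2l.
by apply: perm_cat; apply: perm_map.
Qed.

Lemma smRSK_surj k m (a : k.-tuple nat) (b : m.-tuple nat) n l T1 T2 :
    is_partition n l -> SSMT l a b T1 -> SSMT l a b T2 ->
  exists2 p, restricted_mpartitions a b p & smRSK n p = (T1, T2).
Proof.
move=> pl h1 h2.
have [T [s [uT T1E shT ss]]] := SSMT_first_row _ _ _ _ _ _ _ pl h1.
have [U [s' [uU T2E shU ss']]] := SSMT_first_row _ _ _ _ _ _ _ pl h2.
have [yT ssT aT os] := uT; have [yU ssU aU os'] := uU.
have nonempty T0 (s0 : seq block) : admissible k m a b (flatten T0 ++ s0) ->
    mset0 \notin flatten T0.
  by case=> + _ _; rewrite mem_cat negb_or => /andP[].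
have [P [cP sP rP]] := semistandard_entries _ yT ssT (nonempty _ _ aT).
have [Q [cQ sQ rQ]] := semistandard_entries _ yU ssU (nonempty _ _ aU).
have pPQ : perm_eq (boxes P) (boxes Q).
  by apply: (shape_reps _ _ _ _ rP rQ) => //; rewrite shT shU.
have [w r] := rsk_surj _ _ cP sP cQ pPQ.
have [_ [vP vQ]] := rsk_shape _ _ _ r.
have sw : sorted pair_ltw w by rewrite (rsk_sorted _ _ _ r).
have [swle cw] := (sorted_pair_ltw w).1 sw.
have pT : perm_eq (flatten T ++ s) ([seq y.2 | y <- w] ++ s).
  rewrite perm_cat2r; exact: perm_trans (reps_flatten _ _ cP rP) vP.
have pU : perm_eq (flatten U ++ s') ([seq y.1 | y <- w] ++ s').
  by rewrite perm_cat2r -vQ; exact: reps_flatten.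
have aT' := admissible_perm _ _ _ _ _ _ pT aT.
have aU' := admissible_perm _ _ _ _ _ _ pU aU.
have [w20 _ _] := aT'; have [w10 _ _] := aU'.
pose p := seq_mset [seq join x | x <- pairs w s s'].
exists p; first by apply/restricted_pairs.
have [pw ps ps'] := pairs_parts _ _ _ w10 w20.
have wE : biword p = w.
  apply: (sorted_eq pair_le_trans pair_le_anti) => //.
  exact: (sort_sorted pair_le_total).
rewrite smRSKE wE; have [P' [Q' [r' rP' rQ']]] := sRSK_rsk w.
have [PE QE] := rsk_det _ _ _ _ _ r r'; subst P' Q'.
rewrite (reps_inj _ _ _ cP rP' rP) (reps_inj _ _ _ cQ rQ' rQ).
rewrite (add_first_row_perm _ _ _ _ ps) (add_first_row_perm _ _ _ _ ps').
by rewrite -T1E -T2E.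
Qed.

Local Close Scope mset_scope.
Local Open Scope classical_set_scope.
Local Open Scope nat_scope.

Theorem proposition3p3 (k m r s n : nat) (a : k.-tuple nat) (b : m.-tuple nat)
    (ha : sumn a = r) (hb : sumn b = s) (hn : 2 * r + 2 * s <= n) :
  let shapes := [set l : seq nat | is_partition n l /\ SSMT l a b !=set0] in
  let pairs := fun l : seq nat => SSMT l a b `*` SSMT l a b in
  trivIset shapes pairs /\
  set_bij (restricted_mpartitions a b) (\bigcup_(l in shapes) pairs l)
    (smRSK n).
Proof.
move=> shapes pairs.
have hn' : 2 * (sumn a + sumn b) <= n by rewrite ha hb mulnDr.
split.
  move=> l l' _ _ [[T T'] [[[[<- _ _ _] _ _ _] _] [[[<- _ _ _] _ _ _] _]]].
  by [].
split.
- move=> p rp; rewrite smRSKE.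
  have [_ _ sh uT uU] := smRSK_parts _ _ _ _ _ rp.
  have bound T t : upper_part k m a b T t -> 2 * (nboxes T + size t) <= n.
    by move/upper_size => h; apply: leq_trans hn'; rewrite leq_pmul2l.
  have [pl hT] := add_first_row_SSMT _ _ _ _ _ _ _ uT (bound _ _ uT).
  have [_ hU] := add_first_row_SSMT _ _ _ _ _ _ _ uU (bound _ _ uU).
  have e : Defs.shape (add_first_row n (sRSK (biword p)).1 (und p))
      = Defs.shape (add_first_row n (sRSK (biword p)).2 (non p)).
    have [yT _ _ _] := uT; have [yU _ _ _] := uU.
    have bT := bound _ _ uT; have bU := bound _ _ uU.
    rewrite !add_first_rowE //; case: ifP => // _ /=.
    have half x : 2 * x <= n -> x <= n by apply: leq_trans; rewrite leq_pmull.
    rewrite (size_first_row _ _ _ (half _ bT)) (size_first_row _ _ _ (half _ bU)).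
    by rewrite /nboxes sh.
  exists (Defs.shape (add_first_row n (sRSK (biword p)).1 (und p))).
    by split=> //; eexists; exact: hT.
  by split=> //=; rewrite e.
- move=> p p' /set_mem rp /set_mem rp'; exact: smRSK_inj hn' rp rp'.
- move=> [T1 T2] [l [pl _] [/= h1 h2]].
  by have [p rp e] := smRSK_surj _ _ _ _ _ _ _ _ pl h1 h2; exists p.
Qed.
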